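(* Let $0<s<1$, let $a=1-2s$, and let $f\in\mathcal D((-L)^s)$. Then an $L^2$-weak solution of the extension problem $$L_aU=(L+\mathcal B_a)U=0\ \text{ in } X\times(0,\infty),\qquad U(\cdot,0)=f,$$ where $\mathcal B_a=\frac{\partial^2}{\partial y^2}+\frac ay\frac{\partial}{\partial y}$, is given by $$U(\cdot,y)=\frac1{\Gamma(s)}\int_0^{+\infty}\bigl(P_t(-L)^sf\bigr)\,e^{-\frac{y^2}{4t}}\,\frac{dt}{t^{1-s}},\qquad y>0.$$ Moreover, one has the Poisson formula $$U(\cdot,y)=\frac{y^{2s}}{2^{2s}\Gamma(s)}\int_0^{+\infty}(P_tf)\,e^{-\frac{y^2}{4t}}\,\frac{dt}{t^{1+s}},\qquad y>0.$$
   Context: $(X,d)$ is a locally compact metric space with a Radon measure $\mu$ supported on $X$. $(\mathcal E,\mathcal F)$ is a Dirichlet form on $L^2(X,\mu)$ (densely defined, closed, symmetric, Markovian bilinear form). $L$ is its generator, i.e. the non-positive self-adjoint operator on $L^2(X,\mu)$ with $\mathcal F=\mathcal D(\sqrt{-L})$ and $\mathcal E(u,v)=\langle\sqrt{-L}u,\sqrt{-L}v\rangle$. $P_t=e^{tL}$ is the heat semigroup. It is assumed that $L$ has no spectral gap, i.e. the spectrum of $-L$ meets $(0,\varepsilon)$ for every $\varepsilon>0$. With the spectral resolution $-L=\int_0^\infty\lambda\,dE(\lambda)$, set $\phi(-L)=\int_0^\infty\phi(\lambda)\,dE(\lambda)$ with domain $\{u\in L^2(X,\mu):\int_0^\infty\phi(\lambda)^2\,dE_{u,u}(\lambda)<\infty\}$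 for non-negative continuous $\phi$ on $[0,\infty)$; $(-L)^s$ corresponds to $\phi(\lambda)=\lambda^s$. $\Gamma(s)$ denotes Euler's Gamma function. The $L^2(X,\mu)$-valued integrals in $t$ are understood weakly, by pairing with $g\in L^2(X,\mu)$. ''$L^2$-weak solution'' means: for each $y>0$, $U(\cdot,y)\in L^2(X,\mu)$ belongs to the domain of $L$, $U$ is twice differentiable in $y>0$ in the weak sense of $L^2(X,\mu)$, $\langle LU(\cdot,y)+\mathcal B_aU(\cdot,y),g\rangle_{L^2(X,\mu)}=0$ for all $y>0$ and all $g\in L^2(X,\mu)$, and $\langle U(\cdot,y),g\rangle\to\langle f,g\rangle$ as $y\to0^+$ for all $g\in L^2(X,\mu)$.
   Formalization: The first formula, and its equality with the Poisson formula, are claimed only for f orthogonal to ker L: if 0 is an eigenvalue and f in ker L is nonzero, the first formula gives U=0, which does not tend to f. The Poisson formula is shown to give a solution for every f in D((-L)^s). *)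

(* Defs.v *)
From HB Require Import structures.
From mathcomp Require Import all_boot all_order all_algebra.
From mathcomp Require Import all_classical all_reals all_analysis.

Set Implicit Arguments.
Unset Strict Implicit.
Unset Printing Implicit Defensive.

Import Order.TTheory GRing.Theory Num.Theory.
Import numFieldNormedType.Exports.

Local Open Scope classical_set_scope.
Local Open Scope ring_scope.

(* [g_sigma_algebraType] is a measurable type only over a pointed type. *)
#[short(type="pmetricType")]
HB.structure Definition PointedMetric (K : numDomainType) :=
  {M of Pointed M & Metric K M}.

Notation borelType X := (g_sigma_algebraType (@open X)).

Section radon.
Context {R : realType} {X : pmetricType R}.
Variable mu : {measure set (borelType X) -> \bar R}.
Implicit Types (K V A : set X).

Record radon_measure : Prop := {
  radon_compact : forall K, compact K -> (mu K < +oo)%E ;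
  radon_outer : forall A, measurable (A : set (borelType X)) ->
    mu A = ereal_inf [set mu V | V in [set V | open V /\ A `<=` V]] ;
  radon_inner : forall V, open V ->
    mu V = ereal_sup [set mu K | K in [set K | compact K /\ K `<=` V]] }.

Definition msupport : set X :=
  [set x | forall V, open V -> V x -> (0 < mu V)%E].

End radon.

(* Elements of L^2(mu) are represented by square-integrable functions, so every
   notion below is stated up to almost-everywhere equality. *)
Notation L2 mu := (LfunType mu (lee1n 2)).

Section hilbert.
Context d {T : measurableType d} {R : realType}.
Context {mu : {measure set T -> \bar R}}.
Implicit Types (u v w g : L2 mu) (D : set (L2 mu)).

Definition l2eq u v : Prop := (u : T -> R) = (v : T -> R) %[ae mu].

Definition l2dot u v : R := \int[mu]_x (u x * v x).

Definition l2norm u : R := fine ('N[mu]_2%:E [EFin \o u])%E.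

Definition l2dense D :=
  forall u (e : R), 0 < e -> exists2 v, D v & l2norm (u - v) < e.

Record l2subspace D : Prop := {
  l2subspace_ae : forall u v, l2eq u v -> D u -> D v ;
  l2subspace0 : D 0 ;
  l2subspaceP : forall (c : R) u v, D u -> D v -> D (c *: u + v) }.

End hilbert.

Section dirichlet_form.
Context d {T : measurableType d} {R : realType}.
Context {mu : {measure set T -> \bar R}}.
Variables (F : set (L2 mu)) (E : L2 mu -> L2 mu -> R).
Implicit Types (u v w : L2 mu).

Definition energy1 u : R := E u u + l2dot u u.

Definition closed_form := forall u_ : nat -> L2 mu,
  (forall n, F (u_ n)) ->
  (forall e : R, 0 < e -> exists N : nat, forall m n : nat,
     (N <= m)%N -> (N <= n)%N -> energy1 (u_ m - u_ n) < e) ->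
  exists2 u, F u & energy1 (u_ n - u) @[n --> \oo] --> (0 : R).

Definition markovian_form := forall u v, F u ->
  (forall x, v x = Num.min (Num.max (u x) 0) 1) -> F v /\ E v v <= E u u.

Record dirichlet_form : Prop := {
  dirichlet_subspace : l2subspace F ;
  dirichlet_dense : l2dense F ;
  dirichlet_ae : forall u u' v, F u -> F v -> l2eq u u' -> E u v = E u' v ;
  dirichlet_linear : forall (c : R) u v w, F u -> F v -> F w ->
    E (c *: u + v) w = c * E u w + E v w ;
  dirichlet_sym : forall u v, F u -> F v -> E u v = E v u ;
  dirichlet_ge0 : forall u, F u -> 0 <= E u u ;
  dirichlet_closed : closed_form ;
  dirichlet_markovian : markovian_form }.

End dirichlet_form.

Section operators.
Context d {T : measurableType d} {R : realType}.
Variable mu : {measure set T -> \bar R}.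
Implicit Types (u v w : L2 mu).

(* [op_app] is only meaningful on [op_dom]. *)
Record operator := Operator {
  op_dom : set (L2 mu) ;
  op_app :> L2 mu -> L2 mu }.

Implicit Types A B : operator.

Definition op_eq A B :=
  op_dom A = op_dom B /\ forall u, op_dom A u -> l2eq (A u) (B u).

Definition opN A := Operator (op_dom A) (fun u => - A u).

Record linear_op A : Prop := {
  linear_op_dom : l2subspace (op_dom A) ;
  linear_op_ae : forall u v, op_dom A u -> l2eq u v -> l2eq (A u) (A v) ;
  linear_opP : forall (c : R) u v, op_dom A u -> op_dom A v ->
    l2eq (A (c *: u + v)) (c *: A u + A v) }.

(* The right-hand side of [self_adjoint_graph] says that v is in the domain of
   the adjoint of A and is mapped to w by it. *)
Record self_adjoint A : Prop := {
  self_adjoint_linear : linear_op A ;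
  self_adjoint_dense : l2dense (op_dom A) ;
  self_adjoint_graph : forall v w,
    (op_dom A v /\ l2eq (A v) w) <->
    (forall u, op_dom A u -> l2dot (A u) v = l2dot u w) }.

Definition nonpositive_op A := forall u, op_dom A u -> l2dot (A u) u <= 0.

(* For self-adjoint A the spectrum is real, so real l suffice. *)
Definition resolvent_set A : set R := [set l |
  (exists C : R, forall u, op_dom A u -> l2norm u <= C * l2norm (A u - l *: u))
  /\ (forall v, exists2 u, op_dom A u & l2eq (A u - l *: u) v)].

Definition spectrum A : set R := ~` resolvent_set A.

Definition no_spectral_gap A :=
  forall e : R, 0 < e -> (spectrum A `&` `]0, e[) !=set0.

Definition op_ker A : set (L2 mu) := [set u | op_dom A u /\ l2eq (A u) 0].

End operators.

Section charge_integral.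
Context d {T : measurableType d} {R : realType}.
Variable nu : {charge set T -> \bar R}.

Lemma hahn_ex : exists PN : set T * set T, hahn_decomposition nu PN.1 PN.2.
Proof. by have [P [N h]] := Hahn_decomposition nu; exists (P, N). Qed.

Definition hahnP := projT2 (cid hahn_ex).

(* Integral against a signed measure through its Jordan decomposition; it does
   not depend on the chosen Hahn decomposition (Hahn_decomposition_uniq). *)
Definition charge_integral (D : set T) (f : T -> \bar R) : \bar R :=
  (\int[jordan_pos hahnP]_(x in D) f x
   - \int[jordan_neg hahnP]_(x in D) f x)%E.

End charge_integral.

Section spectral_measure.
Context d {T : measurableType d} {R : realType}.
Variable mu : {measure set T -> \bar R}.
Implicit Types (u v g : L2 mu).

(* Projection-valued measures on the Borel sets of the real line. *)
Record spectralMeasure := SpectralMeasure {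
  spec_proj :> set (measurableTypeR R) -> L2 mu -> L2 mu ;
  spec_linear : forall A, measurable A -> forall (c : R) u v,
    l2eq (spec_proj A (c *: u + v)) (c *: spec_proj A u + spec_proj A v) ;
  spec_sym : forall A, measurable A -> forall u v,
    l2dot (spec_proj A u) v = l2dot u (spec_proj A v) ;
  spec_setI : forall A B, measurable A -> measurable B -> forall u,
    l2eq (spec_proj (A `&` B) u) (spec_proj A (spec_proj B u)) ;
  spec_setT : forall u, l2eq (spec_proj setT u) u ;
  spec_sigma_additive : forall F : nat -> set (measurableTypeR R),
    (forall k, measurable (F k)) -> trivIset setT F -> forall u v,
    (\sum_(0 <= k < n) l2dot (spec_proj (F k) u) v) @[n --> \oo] -->
    l2dot (spec_proj (\bigcup_k F k) u) v }.

Variable E : spectralMeasure.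

(* The signed measure A |-> <E(A)u, v>. *)
Definition spec_charge u v : set (measurableTypeR R) -> \bar R :=
  fun A => (l2dot (E A u) v)%:E.

Section charge.
Variables u v : L2 mu.

Let spec_charge_sigma_additive : semi_sigma_additive (spec_charge u v).
Proof.
move=> F mF tF _; under eq_fun do rewrite sumEFin.
by apply: cvg_EFin; [exact: nearW|exact: spec_sigma_additive].
Qed.

Let spec_charge0 : spec_charge u v set0 = 0%E.
Proof.
have := @spec_sigma_additive E (fun=> set0) (fun=> measurable0).
have tF : trivIset [set: nat] (fun=> set0 : set (measurableTypeR R)).
  by move=> i j _ _ [x []].
move=> /(_ tF u v); rewrite bigcup0//.
under eq_fun do rewrite big_const_nat subn0 iter_addr_0.
set c := l2dot _ _ => cv; congr EFin; rewrite -/c.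
have cv1 : (c *+ n.+1 @[n --> \oo]) --> c by rewrite -cvg_shiftS in cv.
have cv0 : (c *+ n.+1 - c *+ n @[n --> \oo]) --> c - c by exact: cvgB.
rewrite subrr in cv0; apply: (cvg_unique _ _ cv0) => //.
by rewrite /=; under eq_fun do rewrite mulrSr addrAC subrr add0r; exact: cvg_cst.
Qed.

Let spec_charge_fin A : measurable A -> spec_charge u v A \is a fin_num.
Proof. by []. Qed.

HB.instance Definition _ := isCharge.Build _ _ _ (spec_charge u v)
  spec_charge0 spec_charge_fin spec_charge_sigma_additive.

End charge.

(* The integral of phi over [0, +oo[ against dE_{u,v}. *)
Definition spec_integral (phi : R -> R) u v : \bar R :=
  charge_integral (spec_charge u v) `[0, +oo[%classic (fun l => (phi l)%:E).

(* phi(A), where A is the integral of l dE(l) over [0, +oo[: on its domain,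
   phi(A)u is the vector representing the functional
   g |-> integral of phi dE_{u,g}. *)
Definition func_calc (phi : R -> R) : operator mu := Operator
  [set u | (spec_integral (fun l => (phi l ^+ 2)%R) u u < +oo)%E]
  (fun u => xget 0 [set v | forall g, (l2dot v g)%:E = spec_integral phi u g]).

Definition spectral_resolution (A : operator mu) :=
  (forall u, l2eq (E `[0, +oo[%classic u) u) /\ op_eq A (func_calc id).

Definition sqrt_op := func_calc Num.sqrt.
Definition pow_op (s : R) := func_calc (fun l => l `^ s).
Definition heat (t : R) := func_calc (fun l => expR (- (t * l))).

End spectral_measure.

(* E is the spectral measure of -L. *)
Record generator d {T : measurableType d} {R : realType}
    {mu : {measure set T -> \bar R}} (F : set (L2 mu))
    (form : L2 mu -> L2 mu -> R) (E : spectralMeasure mu) (L : operator mu)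
    : Prop := {
  generator_self_adjoint : self_adjoint L ;
  generator_nonpositive : nonpositive_op L ;
  generator_spectral : spectral_resolution E (opN L) ;
  generator_dom : F = op_dom (sqrt_op E) ;
  generator_form : forall u v, F u -> F v ->
    form u v = l2dot (sqrt_op E u) (sqrt_op E v) }.

Section extension.
Context d {T : measurableType d} {R : realType}.
Context {mu : {measure set T -> \bar R}}.
Implicit Types (U V G : R -> L2 mu) (f g v : L2 mu).

Definition gammaR (s : R) : R :=
  \int[lebesgue_measure]_(t in `]0, +oo[) (t `^ (s - 1) * expR (- t)).

Definition weak_integral_of G v := forall g,
  lebesgue_measure.-integrable `]0, +oo[%classic (fun t => (l2dot (G t) g)%:E)
  /\ l2dot v g = \int[lebesgue_measure]_(t in `]0, +oo[) l2dot (G t) g.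

Definition weakly_integrable G := exists v, weak_integral_of G v.

Definition weak_integral G : L2 mu := xget 0 [set v | weak_integral_of G v].

Definition weak_derivative U V := forall (y : R), 0 < y -> forall g,
  is_derive y 1 (fun z : R => l2dot (U z) g) (l2dot (V y) g).

(* U1 and U2 are the first and second weak derivatives of U in y. *)
Definition l2_weak_solution (L : operator mu) (a : R) U f :=
  (forall y, 0 < y -> op_dom L (U y)) /\
  (exists U1 U2 : R -> L2 mu,
    [/\ weak_derivative U U1, weak_derivative U1 U2 &
      forall y, 0 < y -> forall g,
        l2dot (L (U y) + (U2 y + (a / y) *: U1 y)) g = 0]) /\
  (forall g, l2dot (U y) g @[y --> 0^'+] --> l2dot f g).

Variable E : spectralMeasure mu.

Definition extension_integrand (s : R) f (y t : R) : L2 mu :=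
  (expR (- (y ^+ 2 / (4 * t))) / t `^ (1 - s)) *: heat E t (pow_op E s f).

(* On ker L this vanishes, since (-L)^s f = 0 there: it recovers f at y = 0 only
   when f is orthogonal to ker L.  [poisson] recovers every f. *)
Definition extension (s : R) f (y : R) : L2 mu :=
  (gammaR s)^-1 *: weak_integral (extension_integrand s f y).

Definition poisson_integrand (s : R) f (y t : R) : L2 mu :=
  (expR (- (y ^+ 2 / (4 * t))) / t `^ (1 + s)) *: heat E t f.

Definition poisson (s : R) f (y : R) : L2 mu :=
  (y `^ (2 * s) / (2 `^ (2 * s) * gammaR s)) *:
  weak_integral (poisson_integrand s f y).

End extension.

(* Main.v *)
(* On the spectral side the problem is one ODE for each lambda >= 0.  With
     psi(y, lambda) = Gamma(s)^-1 int_0^oo r^(s-1) e^-r e^(-y^2 lambda/(4r)) dr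
   the substitution t = y^2/(4r) turns the Poisson integral of the multiplier
   e^(-t lambda) into psi, and t = r/lambda does the same for the integral
   defining U when lambda > 0.  All the y-dependence of psi sits in a bounded
   exponential, so psi can be differentiated twice under the integral sign, and
     psi_yy + (a/y) psi_y - lambda psi
   is a multiple of the integral over r of the derivative of
   r^(s-1) e^(-r - y^2 lambda/(4r)), which vanishes.  As psi is bounded and tends
   to 1 when y -> 0, the operator psi(y, -L) f is the solution.  At lambda = 0 the
   integral defining U vanishes, whence the orthogonality to ker L. *)
Require Import Defs.
From HB Require Import structures.
From mathcomp Require Import all_boot all_order all_algebra.
From mathcomp Require Import all_classical all_reals all_analysis.
From mathcomp Require Import measurable_realfun ring lra.

Set Implicit Arguments.
Unset Strict Implicit.
Unset Printing Implicit Defensive.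

Import Order.TTheory GRing.Theory Num.Theory.
Import numFieldNormedType.Exports.

Local Open Scope classical_set_scope.
Local Open Scope ring_scope.

(** * Square-integrable functions *)

(** The spectral measure is only a family of projections, and [func_calc] picks a vector from its
    pairings, so phi(-L) u has to be built before it can be used. The obstacle is that each pairing
    is an integral against the signed measure <E(A) u, g>, where sums and limits may meet +oo - +oo.
    What removes it: if (P, N) is a Hahn decomposition of this charge, its Jordan parts are <E(A) u,
    E(P) g> and <E(A) u, -E(N) g>, again spectral pairings of the same u. Limits and exchanges of
    integrals are thus carried out on each positive measure separately. Nonnegative multipliers are
    reached through simple functions and the completeness of L^2; bounded signed ones, needed for
    the y-derivatives, are differences of nonnegative ones. That U(y) lies in the domain of L is not
    read off from its integral: the differential equation bounds lambda psi(y, lambda) uniformly in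
    lambda, and self-adjointness of L then gives both the membership and the value of L U(y). *)

Section l2_inner_product.
Context d {T : measurableType d} {R : realType}.
Context {mu : {measure set T -> \bar R}}.
Implicit Types (u v w g : L2 mu).

Lemma l2dot_integrable u v :
  mu.-integrable [set: T] (EFin \o (fun x => u x * v x)).
Proof. exact/Lfun1_integrable/(Lfun2_mul_Lfun1 (LfunP u) (LfunP v)). Qed.

Lemma l2dotC u v : l2dot u v = l2dot v u.
Proof. by rewrite /l2dot; under eq_Rintegral do rewrite mulrC. Qed.

Lemma l2dotDl u v w : l2dot (u + v) w = l2dot u w + l2dot v w.
Proof.
rewrite /l2dot -RintegralD//; try exact: l2dot_integrable.
by apply: eq_Rintegral => x _; rewrite -mulrDl.
Qed.

Lemma l2dotZl (c : R) u v : l2dot (c *: u) v = c * l2dot u v.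
Proof.
rewrite /l2dot -RintegralZl//; last exact: l2dot_integrable.
by apply: eq_Rintegral => x _; rewrite mulrA.
Qed.

Lemma l2dotNl u v : l2dot (- u) v = - l2dot u v.
Proof. by rewrite -scaleN1r l2dotZl mulN1r. Qed.

Lemma l2dotBl u v w : l2dot (u - v) w = l2dot u w - l2dot v w.
Proof. by rewrite l2dotDl l2dotNl. Qed.

Lemma l2dot0l v : l2dot 0 v = 0.
Proof. by rewrite -(scale0r 0) l2dotZl mul0r. Qed.

Lemma l2dotDr u v w : l2dot u (v + w) = l2dot u v + l2dot u w.
Proof. by rewrite l2dotC l2dotDl !(l2dotC u). Qed.

Lemma l2dotZr (c : R) u v : l2dot u (c *: v) = c * l2dot u v.
Proof. by rewrite l2dotC l2dotZl (l2dotC u). Qed.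

Lemma l2dotNr u v : l2dot u (- v) = - l2dot u v.
Proof. by rewrite l2dotC l2dotNl l2dotC. Qed.

Lemma l2dotBr u v w : l2dot u (v - w) = l2dot u v - l2dot u w.
Proof. by rewrite l2dotC l2dotBl !(l2dotC u). Qed.

Lemma l2dot_ge0 u : 0 <= l2dot u u.
Proof. by apply: Rintegral_ge0 => x _; rewrite -expr2 sqr_ge0. Qed.

Lemma eq_l2dotl u v w : l2eq u v -> l2dot u w = l2dot v w.
Proof.
move=> uv; rewrite /l2dot/Rintegral; congr fine.
apply: ae_eq_integral => //.
- exact/measurable_EFinP/measurable_funM.
- exact/measurable_EFinP/measurable_funM.
- by apply: filterS uv => x /= uv _; rewrite uv.
Qed.

Lemma l2dot_eq0 u : l2dot u u = 0 -> l2eq u 0.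
Proof.
move=> u0.
have mu2 : measurable_fun setT (EFin \o (fun x => u x * u x)).
  exact/measurable_EFinP/measurable_funM.
have : (\int[mu]_x `|(EFin \o (fun x => u x * u x)%R) x| = 0)%E.
  under eq_integral do rewrite /= ger0_norm -?expr2 ?sqr_ge0//.
  have /fineK <- : (\int[mu]_x (u x ^+ 2)%:E)%E \is a fin_num.
    under eq_integral do rewrite expr2.
    exact: integrable_fin_num (l2dot_integrable _ _).
  by move: u0; rewrite /l2dot/Rintegral; under eq_integral do rewrite -expr2; move=> ->.
move/(ae_eq_integral_abs mu measurableT mu2).
apply: filterS => x /= /(_ I) [] /eqP; rewrite mulf_eq0 orbb => /eqP -> _.
by [].
Qed.

Lemma l2eqP u v : (forall g, l2dot u g = l2dot v g) -> l2eq u v.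
Proof.
move=> uv; have /l2dot_eq0 : l2dot (u - v) (u - v) = 0.
  by rewrite l2dotBl uv subrr.
by apply: filterS => x /= /(_ I) /eqP; rewrite subr_eq0 => /eqP.
Qed.

(* AM-GM, in place of Cauchy-Schwarz. *)
Lemma ler_normr_l2dot (c : R) u v : 0 < c ->
  `|l2dot u v| <= c * l2dot u u + c^-1 * l2dot v v.
Proof.
move=> c0.
have h (e : R) : e ^+ 2 = 1 -> 0 <= c * l2dot u u + c^-1 * l2dot v v + 2 * e * l2dot u v.
  move=> e2; have := l2dot_ge0 (c *: u + e *: v).
  rewrite l2dotDl !l2dotDr !l2dotZl !l2dotZr (l2dotC v u) => h.
  have -> : c * l2dot u u + c^-1 * l2dot v v + 2 * e * l2dot u v =
    c^-1 * (c * (c * l2dot u u) + c * (e * l2dot u v) +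
     (e * (c * l2dot u v) + e * (e * l2dot v v))).
    by rewrite [e * (e * _)]mulrA -expr2 e2; field; rewrite gt_eqF.
  by rewrite mulr_ge0// invr_ge0 ltW.
have := h 1 (expr1n _ _); have := h (-1).
rewrite sqrrN expr1n => /(_ erefl).
have := mulr_ge0 (ltW c0) (l2dot_ge0 u).
have : 0 <= c^-1 * l2dot v v by rewrite mulr_ge0 ?l2dot_ge0// invr_ge0 ltW.
by rewrite ler_norml; lra.
Qed.

End l2_inner_product.

(** * Completeness of L^2 *)

Section l2_completeness.
Context d {T : measurableType d} {R : realType}.
Context {mu : {measure set T -> \bar R}}.
Implicit Types (u v w g : L2 mu).

Lemma Lfun2_sqr (f : T -> R) : measurable_fun setT f ->
  (\int[mu]_x (f x ^+ 2)%:E < +oo)%E -> f \in Lfun mu 2%:E.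
Proof.
move=> mf f2; rewrite inE; apply/andP; split; rewrite inE//=.
rewrite /finite_norm unlock poweR_lty//.
by under eq_integral do rewrite /= powR_mulrn// real_normK ?num_real//.
Qed.

Lemma l2dotE u : (l2dot u u)%:E = (\int[mu]_x (u x ^+ 2)%:E)%E.
Proof.
rewrite /l2dot/Rintegral fineK; last first.
  exact: integrable_fin_num (l2dot_integrable u u).
by apply: eq_integral => x _; rewrite expr2.
Qed.

Lemma limn_einf_le_near (u : nat -> \bar R) (l : \bar R) N :
  (forall n, (N <= n)%N -> (u n <= l)%E) -> (limn_einf u <= l)%E.
Proof.
move=> ul; rewrite limn_einf_lim; apply: lime_le.
  exact: is_cvg_einfs.
apply: nearW => n; rewrite /einfs (@le_trans _ _ (u (maxn n N)))//.
  by apply: ereal_inf_lbound => /=; exists (maxn n N) => //=; exact: leq_maxl.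
by apply: ul; rewrite leq_maxr.
Qed.

(* |d| <= 2^-k + 2^k d^2 bounds the increments by a summable sequence. *)
Lemma is_cvg_weighted_increments (w : nat -> R) :
  (\sum_(0 <= k <oo) (2 ^+ k * (w k.+1 - w k) ^+ 2)%:E < +oo)%E ->
  cvgn w.
Proof.
set W := limn _ => Wy.
have W0 : (0 <= W)%E.
  by apply: nneseries_ge0 => k _ _; rewrite lee_fin mulr_ge0 ?sqr_ge0.
have Wf : W \is a fin_num by rewrite ge0_fin_numE.
have -> : w = cst (w 0%N) + series (telescope w).
  by apply/funext => n; rewrite [LHS]eq_sum_telescope.
apply: is_cvgD; first exact: is_cvg_cst.
apply: normed_cvg.
apply: (@series_le_cvg _ _ (fun k => 2^-1 ^+ k + 2 ^+ k * (w k.+1 - w k) ^+ 2)).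
- by move=> k; exact: normr_ge0.
- by move=> k; apply: addr_ge0; [exact: exprn_ge0|apply: mulr_ge0 (sqr_ge0 _); exact: exprn_ge0].
- move=> k /=; rewrite /telescope exprVn.
  set x := w _ - _; rewrite -[x ^+ 2]real_normK ?num_real//.
  have p0 : (0 : R) < 2 ^+ k by rewrite exprn_gt0.
  have n0 := normr_ge0 x; move: (2 ^+ k) p0 `|x| n0 => p p0 y y0.
  have [py|py] := leP (p * y) 1.
    rewrite (@le_trans _ _ p^-1)//; first by rewrite -[leRHS]mulr1 ler_pdivlMl.
    by rewrite lerDl mulr_ge0 ?sqr_ge0// ltW.
  rewrite (@le_trans _ _ (p * y ^+ 2))//; last by rewrite lerDr invr_ge0 ltW.
  by rewrite expr2 mulrA ler_peMl// ltW.
- rewrite [X in cvgn X](_ : _ = series (fun k => 2^-1 ^+ k) +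
    series (fun k => 2 ^+ k * (w k.+1 - w k) ^+ 2)); last first.
    by apply/funext => n; rewrite /series/= big_split.
  apply: is_cvgD.
    have /= := @is_cvg_geometric_series R 1 2^-1.
    rewrite /geometric/=; under eq_fun do rewrite mul1r.
    by apply; rewrite ger0_norm ?invr_ge0// invf_lt1// ltr1n.
  apply: nondecreasing_is_cvgn.
    apply/nondecreasing_seqP => n; rewrite /series/= big_nat_recr//= lerDl.
    by rewrite mulr_ge0 ?sqr_ge0.
  exists (fine W) => _ [n _ <-]; rewrite -lee_fin fineK// /series/= -sumEFin.
  by apply: nneseries_lim_ge => k _ _; rewrite lee_fin mulr_ge0 ?sqr_ge0.
Qed.

(** Riesz-Fischer: a subsequence with summable weighted increments converges almost everywhere, and
    Fatou's lemma upgrades this to convergence in norm of the whole sequence. *)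
Lemma l2_complete (v_ : nat -> L2 mu) :
  (forall e : R, 0 < e -> exists N, forall m n, (N <= m)%N -> (N <= n)%N ->
    l2dot (v_ m - v_ n) (v_ m - v_ n) < e) ->
  exists v, forall e : R, 0 < e -> exists N, forall n, (N <= n)%N ->
    l2dot (v_ n - v) (v_ n - v) <= e.
Proof.
move=> cau.
(* The factor 2^-k absorbs the weight 2^k of [is_cvg_weighted_increments]; what is left, 2^-(k+1),
   has sum at most 1. *)
pose e_ k : R := 2^-1 ^+ k * (1 / (2 ^ k.+1)%:R).
have e0 k : 0 < e_ k by rewrite mulr_gt0 ?exprn_gt0// divr_gt0// ltr0n expn_gt0.
have [N_ N_P] := choice (fun k => cau _ (e0 k)).
(* The sum puts [n_ k] beyond [N_ j] for every j <= k; the summand k gives [n_ k >= k], which the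
   Fatou step needs. *)
pose n_ k := (k + \sum_(j < k.+1) N_ j)%N.
have n_N j k : (j <= k)%N -> (N_ j <= n_ k)%N.
  move=> jk; rewrite /n_ (bigD1 (inord j : 'I_k.+1))//=.
  by rewrite inordK// addnCA leq_addr.
pose w_ k := v_ (n_ k).
have dw k : l2dot (w_ k.+1 - w_ k) (w_ k.+1 - w_ k) < e_ k.
  by apply: N_P; exact: n_N.
pose W x := (\sum_(0 <= k <oo) (2 ^+ k * ((w_ k.+1 x - w_ k x) ^+ 2))%:E)%E.
have W_ge0 k x : (0 <= (2 ^+ k * (w_ k.+1 x - w_ k x) ^+ 2)%:E)%E.
  by rewrite lee_fin mulr_ge0 ?sqr_ge0.
have mWk k : measurable_fun setT (fun x => (2 ^+ k * (w_ k.+1 x - w_ k x) ^+ 2)%:E).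
  apply/measurable_EFinP/measurable_funM => //; apply: measurable_funX.
  exact: measurable_funB.
have mW : measurable_fun setT W.
  exact: ge0_emeasurable_sum.
have W0 x : (0 <= W x)%E by apply: nneseries_ge0 => k _ _.
have intW : mu.-integrable setT W.
  apply/integrableP; split => //.
  under eq_integral do rewrite gee0_abs//.
  rewrite integral_nneseries//.
  apply: (@le_lt_trans _ _ (\sum_(0 <= k <oo) (1 / (2 ^ k.+1)%:R)%:E)%E); last first.
    exact: le_lt_trans (epsilon_trick0 _ ler01) (ltry _).
  apply: lee_nneseries => [k _ _|k _ /=]; first exact: integral_ge0.
  under eq_integral do rewrite EFinM.
  rewrite ge0_integralZl//; last 2 first.
    apply/measurable_EFinP; apply: measurable_funX.
    exact: measurable_funB.
    by move=> x _; rewrite lee_fin sqr_ge0.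
  have := ltW (dw k); rewrite -lee_fin l2dotE.
  move=> /(lee_wpmul2l _) => /(_ (2 ^+ k)%:E); rewrite lee_fin exprn_ge0//.
  move=> /(_ isT) /le_trans; apply.
  rewrite -EFinM lee_fin /e_ exprVn. by rewrite mulVKf// expf_neq0.
have aeW : {ae mu, forall x, cvgn (fun k => w_ k x)}.
  have := integrable_ae measurableT intW; apply: filterS => x /(_ I) Wx.
  apply: is_cvg_weighted_increments.
  by move: Wx; rewrite ge0_fin_numE.
(* The upper limit is measurable on all of [T]; it agrees with the limit wherever that exists. *)
pose v x := fine (limn_esup (fun k => (w_ k x)%:E)).
have mv : measurable_fun setT v.
  apply: measurableT_comp => //.
  by apply: measurable_fun_limn_esup => k; exact/measurable_EFinP.
have aev : {ae mu, forall x, w_ k x @[k --> \oo] --> v x}.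
  apply: filterS aeW => x cx; rewrite /v.
  have c : (w_ k x)%:E @[k --> \oo] --> (limn (fun k => w_ k x))%:E.
    by apply: cvg_EFin => //; exact: nearW.
  by rewrite limn_esup_lim (cvg_lim _ (cvg_esups c))//.
have vN (e : R) N : (forall m n, (N <= m)%N -> (N <= n)%N ->
    l2dot (v_ m - v_ n) (v_ m - v_ n) < e) ->
  forall n, (N <= n)%N -> (\int[mu]_x ((v x - v_ n x) ^+ 2)%:E <= e%:E)%E.
  move=> NP n Nn.
  pose h k x := ((w_ k x - v_ n x) ^+ 2)%:E.
  have mh k : measurable_fun setT (h k).
    by apply/measurable_EFinP/measurable_funX/measurable_funB.
  rewrite (@ae_eq_integral _ _ _ mu _ (fun x => limn_einf (h ^~ x)))//; last 3 first.
  - by apply/measurable_EFinP/measurable_funX/measurable_funB.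
  - apply: measurableT_comp => //; apply: measurable_fun_limn_esup => k.
    exact: measurableT_comp.
  - apply: filterS aev => x cx _; apply/esym.
    have c : h k x @[k --> \oo] --> ((v x - v_ n x) ^+ 2)%:E.
      apply: cvg_EFin; first exact: nearW.
      rewrite /comp/=; under eq_fun do rewrite expr2.
      by rewrite expr2; apply: cvgM; apply: cvgB => //; exact: cvg_cst.
    by rewrite limn_einf_lim (cvg_lim _ (cvg_einfs c)).
  (* Almost everywhere |v - v_n|^2 is the limit in k of |w_k - v_n|^2, whose integral is below e as
     soon as k >= N. *)
  apply: le_trans (fatou _ _ _ _) _ => //.
    by move=> k x _; rewrite lee_fin sqr_ge0.
  apply: (@limn_einf_le_near _ _ N) => k Nk.
  rewrite (_ : (\int[mu]_x h k x)%E = (l2dot (w_ k - v_ n) (w_ k - v_ n))%:E).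
    by rewrite lee_fin ltW// NP// /n_ (leq_trans Nk)// leq_addr.
  by rewrite l2dotE.
have [N NP] := cau 1 ltr01.
have := vN _ _ NP _ (leqnn N) => vN1.
(* Fatou controls only the differences, so the limit enters L^2 as (v - v_N) + v_N. *)
have vL : (fun x => v x - v_ N x) \in Lfun mu 2%:E.
  apply: Lfun2_sqr; first exact: measurable_funB.
  by rewrite (le_lt_trans vN1) ?ltry.
exists (Lfun_Sub (lee1n 2) vL + v_ N) => e /cau [M MP]; exists M => n Mn.
rewrite -lee_fin l2dotE (le_trans _ (vN _ _ MP _ Mn))//.
apply: ge0_le_integral => //.
- by move=> x _; rewrite lee_fin sqr_ge0.
- apply/measurable_EFinP; apply: measurable_funX; exact: measurable_funPT.
- by apply/measurable_EFinP/measurable_funX/measurable_funB.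
- move=> x _; rewrite lee_fin -sqrrN.
  suff -> : - (v_ n - (Lfun_Sub (lee1n 2) vL + v_ N)) x = v x - v_ n x by [].
  by rewrite opprB /= subrK.
Qed.

Lemma l2_weak_complete (v_ : nat -> L2 mu) :
  (forall e : R, 0 < e -> exists N, forall m n, (N <= m)%N -> (N <= n)%N ->
    l2dot (v_ m - v_ n) (v_ m - v_ n) < e) ->
  exists v, forall g, l2dot (v_ n) g @[n --> \oo] --> l2dot v g.
Proof.
move=> /l2_complete [v vP]; exists v => g; apply/cvgrPdist_le => /= e e0.
(* Chosen so that c^-1 |g|^2 <= e / 2; the added 1 keeps c positive when g vanishes. *)
pose c := (l2dot g g + 1) * 2 / e.
have g1 : 0 < l2dot g g + 1 by have := l2dot_ge0 g; lra.
have c0 : 0 < c by rewrite divr_gt0// mulr_gt0.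
have [|N NP] := vP (e / 2 / c); first by apply: divr_gt0 => //; exact: divr_gt0.
exists N => // n /= /NP vn; rewrite distrC -l2dotBl.
apply: le_trans (ler_normr_l2dot _ _ c0) _; rewrite [leRHS](splitr e) lerD//.
  by rewrite mulrC -ler_pdivlMr.
rewrite /c invf_div mulrAC ler_pdivrMr ?mulr_gt0//.
by rewrite [leRHS](_ : _ = e * (l2dot g g + 1)); [rewrite ler_wpM2l ?lerDl// ltW|field].
Qed.

End l2_completeness.

(** * Integration against signed measures *)

Section density_measure.
Context d {T : measurableType d} {R : realType}.
Variables (m : {measure set T -> \bar R}) (p : T -> R).
Hypothesis mp : measurable_fun setT p.
Hypothesis p0 : forall x, 0 <= p x.
Local Open Scope ereal_scope.

(** The two proofs are arguments of the definition so that its measure structure can be inferred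
    from the term. *)
Definition density_measure of measurable_fun setT p & (forall x, (0 <= p x)%R) :=
  fun A : set T => \int[m]_(x in A) (p x)%:E.

Local Notation pm := (density_measure mp p0).

Let pm0 : pm set0 = 0. Proof. exact: integral_set0. Qed.

Let pm_ge0 A : 0 <= pm A.
Proof. by apply: integral_ge0 => x _; rewrite lee_fin. Qed.

Let pm_sigma_additive : semi_sigma_additive pm.
Proof.
apply: semi_sigma_additive_nng_induced; first exact/measurable_EFinP.
by move=> x; rewrite lee_fin.
Qed.

HB.instance Definition _ :=
  isMeasure.Build _ _ _ pm pm0 pm_ge0 pm_sigma_additive.

Import HBNNSimple.

Lemma integral_density (f : T -> \bar R) : (forall x, 0 <= f x) ->
  measurable_fun setT f ->
  \int[pm]_x f x = \int[m]_x (f x * (p x)%:E).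
Proof.
move=> f0 mf; pose h := nnsfun_approx measurableT mf.
have hf x : (h n x)%:E @[n --> \oo] --> f x by exact: cvg_nnsfun_approx.
have mpE : measurable_fun setT (EFin \o p) by exact/measurable_EFinP.
have mh n : measurable_fun setT (fun x => (h n x)%:E).
  exact/measurable_EFinP/measurable_funP.
have h0 n x : 0 <= (h n x)%:E by rewrite lee_fin.
have ndh x : {homo (fun n => (h n x)%:E) : a b / (a <= b)%N >-> a <= b}.
  by move=> a b ab; rewrite lee_fin; exact/lefP/nd_nnsfun_approx.
have c1 := cvg_monotone_convergence measurableT mh (fun n x _ => h0 n x)
  (fun x _ => ndh x) (mu := pm).
have c2 := @cvg_monotone_convergence _ _ _ m setT measurableT
  (fun n x => (h n x)%:E * (p x)%:E).
have c3 : \int[m]_x ((h n x)%:E * (p x)%:E) @[n --> \oo] -->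
    \int[m]_x (f x * (p x)%:E).
  under [X in _ --> X]eq_integral => x _.
    rewrite (_ : f x * (p x)%:E = limn (fun n => (h n x)%:E * (p x)%:E)); last first.
      by apply/esym/cvg_lim => //; apply: cvgeZr.
    over.
  apply: c2.
  - by move=> n; exact: emeasurable_funM.
  - by move=> n x _; rewrite mule_ge0// lee_fin.
  - by move=> x _ a b ab; rewrite lee_wpmul2r ?lee_fin//; exact: (ndh x a b ab).
have {c1}c1 : \int[pm]_x (h n x)%:E @[n --> \oo] --> \int[pm]_x f x.
  under [X in _ --> X]eq_integral => x _.
    rewrite (_ : f x = limn (fun n => (h n x)%:E)); last by apply/esym/cvg_lim.
    over.
  exact: c1.
suff E n : \int[pm]_x (h n x)%:E = \int[m]_x ((h n x)%:E * (p x)%:E).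
  by rewrite -(cvg_lim _ c1)// -(cvg_lim _ c3)//; under eq_fun do rewrite E.
rewrite integralT_nnsfun sintegralE.
under [RHS]eq_integral => x xE.
  rewrite fimfunE -fsumEFin // ge0_mule_fsuml; last first.
    by move=> y; exact: nnfun_muleindic_ge0.
  over.
rewrite ge0_integral_fsum//; last 2 first.
- move=> y; apply: emeasurable_funM => //; exact/measurable_EFinP/measurable_funM.
- by move=> y x _; rewrite mule_ge0 ?lee_fin// -lee_fin; exact: nnfun_muleindic_ge0.
apply: eq_fsbigr => r /[!inE] -[t _ <-].
under eq_integral do rewrite EFinM -muleA.
rewrite ge0_integralZl//; last 2 first.
- by apply: emeasurable_funM => //; exact/measurable_EFinP.
- by move=> x _; rewrite mule_ge0 ?lee_fin.
congr (_ * _); rewrite /= /density_measure integral_mkcond.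
by rewrite epatch_indic; apply: eq_integral => x _; rewrite muleC.
Qed.

End density_measure.

Section charge_integral_density.
Context d {T : measurableType d} {R : realType}.
Local Open Scope ereal_scope.

(** The hypothesis says that [m] plus the measure of density q against [m2] is the measure of
    density q against [m1]. A sum is used because the corresponding difference could be +oo -
    +oo. *)
Lemma integral_add_density (m m1 m2 : {measure set T -> \bar R}) (q : T -> R)
    (f : T -> \bar R) :
  measurable_fun setT q -> (forall x, (0 <= q x)%R) ->
  (forall A, measurable A ->
    m A + \int[m2]_(x in A) (q x)%:E = \int[m1]_(x in A) (q x)%:E) ->
  (forall x, 0 <= f x) -> measurable_fun setT f ->
  \int[m]_x f x + \int[m2]_x (f x * (q x)%:E) = \int[m1]_x (f x * (q x)%:E).
Proof.
move=> mq q0 mE f0 mf; rewrite -!(integral_density _ mq q0)//.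
rewrite -ge0_integral_measure_add//; apply: eq_measure_integral => A mA _.
by rewrite [LHS]measure_addE mE.
Qed.

Variables (nu : {charge set T -> \bar R}) (m1 m2 : {measure set T -> \bar R}).
Variables (p : T -> R) (f : T -> \bar R).
Hypotheses (mp : measurable_fun setT p) (p0 : forall x, (0 <= p x)%R).
Hypotheses (p1y : \int[m1]_x (p x)%:E < +oo) (p2y : \int[m2]_x (p x)%:E < +oo).
Hypothesis nuE : forall A, measurable A ->
  nu A = \int[m1]_(x in A) (p x)%:E - \int[m2]_(x in A) (p x)%:E.
Hypotheses (f0 : forall x, 0 <= f x) (mf : measurable_fun setT f).
Hypotheses (f1y : \int[m1]_x (f x * (p x)%:E) < +oo).
Hypotheses (f2y : \int[m2]_x (f x * (p x)%:E) < +oo).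

Let mpE D : measurable D -> measurable_fun D (EFin \o p).
Proof. by move=> mD; apply/measurable_EFinP/measurable_funTS. Qed.

Let fin_int (m : {measure set T -> \bar R}) (h : T -> \bar R) A :
  measurable_fun setT h -> (forall x, 0 <= h x) -> \int[m]_x h x < +oo ->
  measurable A -> \int[m]_(x in A) h x \is a fin_num.
Proof.
move=> mh h0 hy mA; rewrite ge0_fin_numE ?integral_ge0//.
by apply: le_lt_trans hy; exact: ge0_subset_integral.
Qed.

Let patchE (m : {measure set T -> \bar R}) (h : T -> \bar R) A B :
  \int[m]_(x in A `&` B) h x = \int[m]_(x in A) (h x * (\1_B x)%:E).
Proof. by rewrite integral_mkcondr epatch_indic. Qed.

Let mfp : measurable_fun setT (fun x => f x * (p x)%:E).
Proof. by apply: emeasurable_funM => //; exact: mpE. Qed.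

Let fp0 x : 0 <= f x * (p x)%:E.
Proof. by rewrite mule_ge0// lee_fin. Qed.

Section part.
Variables (B : set T) (m : {measure set T -> \bar R}).
Variables (k1 k2 : {measure set T -> \bar R}).
Hypotheses (mB : measurable B).
Hypothesis k2y : \int[k2]_x (p x)%:E < +oo.
Hypotheses (g1y : \int[k1]_x (f x * (p x)%:E) < +oo).
Hypotheses (g2y : \int[k2]_x (f x * (p x)%:E) < +oo).
Hypothesis mE : forall A, measurable A ->
  m A = \int[k1]_(x in A `&` B) (p x)%:E - \int[k2]_(x in A `&` B) (p x)%:E.

(** To be applied with [B] a Hahn set and [m] a Jordan part of [nu]. The measures [k1] and [k2]
    stand for [m1] and [m2] on the positive set and are exchanged on the negative one. The density
    fed to [integral_add_density] is p times the indicator of [B]. *)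
Lemma integral_density_part : \int[m]_x f x < +oo /\
  \int[m]_x f x = \int[k1]_(x in B) (f x * (p x)%:E) -
                  \int[k2]_(x in B) (f x * (p x)%:E).
Proof.
have fk1 := fin_int mfp fp0 g1y mB; have fk2 := fin_int mfp fp0 g2y mB.
(* With the subtracted term moved to the left, the finite right-hand side forces the integral
   against [m] to be finite, and only then is it subtracted. *)
suff E : \int[m]_x f x + \int[k2]_(x in B) (f x * (p x)%:E) =
    \int[k1]_(x in B) (f x * (p x)%:E).
  split; last by rewrite -E addeK.
  rewrite ltey; apply/eqP => fy; move: fk1; rewrite -E fy addye//.
  by rewrite gt_eqF// (lt_le_trans _ (integral_ge0 _ _)).
rewrite -(setTI B) !patchE.
have mq : measurable_fun setT (p \* (\1_B : T -> R))%R.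
  exact: measurable_funM.
have := @integral_add_density m k1 k2 _ f mq.
under [in X in _ -> X -> _]eq_fun do rewrite /=.
move=> /(_ _ _ f0 mf) E.
under [X in _ + X]eq_integral do rewrite -muleA -EFinM.
under [RHS]eq_integral do rewrite -muleA -EFinM.
apply: E => [x|A mA]; first by rewrite mulr_ge0.
under [X in _ + X]eq_integral do rewrite EFinM.
under [RHS]eq_integral do rewrite EFinM.
by rewrite -!patchE mE// subeK// fin_int//; [exact: mpE|exact: measurableI].
Qed.

End part.

(** [m1] and [m2] may overlap, so the two densities need not be the Jordan parts of [nu]. Cutting
    both along the Hahn sets and regrouping four finite integrals gives the same value. *)
Lemma charge_integral_density :
  [/\ \int[jordan_pos (hahnP nu)]_x f x < +oo,
      \int[jordan_neg (hahnP nu)]_x f x < +oo &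
      charge_integral nu setT f =
        \int[m1]_x (f x * (p x)%:E) - \int[m2]_x (f x * (p x)%:E)].
Proof.
rewrite /charge_integral; move: (hahnP nu); case: (projT1 _) => P N nuPN /=.
have [[mP _] [mN _] PNT PN0] := nuPN; simpl in mP, mN, PNT, PN0.
have pE A : measurable A -> jordan_pos nuPN A =
    \int[m1]_(x in A `&` P) (p x)%:E - \int[m2]_(x in A `&` P) (p x)%:E.
  move=> mA; have mAP := measurableI _ _ mA mP.
  by rewrite jordan_posE cjordan_posE /crestr0 mem_set// /crestr nuE.
have [py pI] := @integral_density_part _ (jordan_pos nuPN) m1 m2 mP
  p2y f1y f2y pE.
have nE A : measurable A -> jordan_neg nuPN A =
    \int[m2]_(x in A `&` N) (p x)%:E - \int[m1]_(x in A `&` N) (p x)%:E.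
  move=> mA; have mAN := measurableI _ _ mA mN.
  rewrite jordan_negE cjordan_negE /crestr0 mem_set// /crestr nuE//.
  have f2 : \int[m2]_(x in A `&` N) (p x)%:E \is a fin_num.
    by apply: fin_int p2y mAN; [exact: mpE|move=> x; rewrite lee_fin].
  by rewrite fin_num_oppeB// addeC.
have [ny nI] := @integral_density_part _ (jordan_neg nuPN) m2 m1 mN
  p1y f2y f1y nE.
split; [exact: py|exact: ny|].
have fN (k : {measure set T -> \bar R}) : \int[k]_x (f x * (p x)%:E) < +oo ->
  \int[k]_(x in N) (f x * (p x)%:E) \is a fin_num.
  by move=> ky; exact: fin_int mfp fp0 ky mN.
have fP (k : {measure set T -> \bar R}) : \int[k]_x (f x * (p x)%:E) < +oo ->
  \int[k]_(x in P) (f x * (p x)%:E) \is a fin_num.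
  by move=> ky; exact: fin_int mfp fp0 ky mP.
have U (k : {measure set T -> \bar R}) :
  \int[k]_x (f x * (p x)%:E) = \int[k]_(x in P) (f x * (p x)%:E) +
    \int[k]_(x in N) (f x * (p x)%:E).
  rewrite -PNT ge0_integral_setU// ?PNT//.
  by apply/disj_setPS => x; rewrite PN0.
rewrite pI nI !U -(fineK (fP _ f1y)) -(fineK (fN _ f1y)) -(fineK (fP _ f2y)).
rewrite -(fineK (fN _ f2y)) -!(EFinN, EFinD); congr EFin; ring.
Qed.

End charge_integral_density.

(** * Functional calculus *)

Section functional_calculus.
Context d {T : measurableType d} {R : realType}.
Context {mu : {measure set T -> \bar R}}.
Variable E : spectralMeasure mu.
Implicit Types (u v g : L2 mu).

Definition spec_pos u g := jordan_pos (hahnP (spec_charge E u g)).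
Definition spec_neg u g := jordan_neg (hahnP (spec_charge E u g)).

HB.instance Definition _ u g := Measure.on (spec_pos u g).
HB.instance Definition _ u g := Measure.on (spec_neg u g).
HB.instance Definition _ u g := @Measure_isFinite.Build _ _ _ (spec_pos u g)
  (fin_num_measure (jordan_pos (hahnP (spec_charge E u g)))).
HB.instance Definition _ u g := @Measure_isFinite.Build _ _ _ (spec_neg u g)
  (fin_num_measure (jordan_neg (hahnP (spec_charge E u g)))).

Lemma spec_setIl A B u g : measurable A -> measurable B ->
  l2dot (E (A `&` B) u) g = l2dot (E A u) (E B g).
Proof.
by move=> mA mB; rewrite setIC (eq_l2dotl _ (spec_setI E mB mA u)) spec_sym.
Qed.

Lemma spec_jordan u g : exists gp gn,
  [/\ forall A, measurable A -> spec_pos u g A = (l2dot (E A u) gp)%:E,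
      forall A, measurable A -> spec_neg u g A = (l2dot (E A u) gn)%:E &
      forall v, l2dot v g = l2dot v gp - l2dot v gn].
Proof.
rewrite /spec_pos /spec_neg; move: (hahnP _); case: (projT1 _) => P N nuPN /=.
have [[mP _] [mN _] PNT PN0] := nuPN; simpl in mP, mN, PNT, PN0.
exists (E P g), (- E N g); split.
- move=> A mA; rewrite jordan_posE cjordan_posE /crestr0 mem_set// /crestr.
  by rewrite /= /spec_charge spec_setIl.
- move=> A mA; rewrite jordan_negE cjordan_negE /crestr0 mem_set// /crestr.
  by rewrite /= /spec_charge spec_setIl// l2dotNr.
- move=> v; rewrite l2dotNr opprK.
  rewrite -!spec_sym// -(eq_l2dotl g (spec_setT E v)) -PNT.
  have := @chargeU _ _ _ (spec_charge E v g) P N mP mN PN0.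
  by rewrite /= /spec_charge => -[].
Qed.

(** <E(A [&] N) u, u> is the square norm of E(A [&] N) u, hence nonnegative, while the charge is
    nonpositive on subsets of N. *)
Lemma spec_neg_diag u A : measurable A -> spec_neg u u A = 0%E.
Proof.
rewrite /spec_neg; move: (hahnP _); case: (projT1 _) => P N nuPN /= mA.
have [_ [mN _] _ _] := nuPN; simpl in mN.
apply/eqP; rewrite eq_le measure_ge0 andbT.
rewrite jordan_negE cjordan_negE /crestr0 mem_set// /crestr leeNl oppe0.
have mAN := measurableI _ _ mA mN.
rewrite /= /spec_charge -[A `&` N]setIid spec_setIl// -spec_sym//.
by rewrite lee_fin spec_sym// l2dot_ge0.
Qed.

Lemma spec_pos_diag u A : measurable A ->
  spec_pos u u A = (l2dot (E A u) u)%:E.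
Proof.
move=> mA; transitivity (spec_pos u u A - spec_neg u u A)%E.
  by rewrite spec_neg_diag// sube0.
rewrite -[RHS]/(spec_charge E u u A) [RHS](jordan_decomp (hahnP (spec_charge E u u)) mA).
exact: (congr1 (fun z => spec_pos u u A + z)%E (esym (mulN1e (spec_neg u u A)))).
Qed.

Local Notation D := `[(0:R), +oo[%classic.

Lemma spec_integralE phi u g : spec_integral E phi u g =
  (\int[spec_pos u g]_(x in D) (phi x)%:E - \int[spec_neg u g]_(x in D) (phi x)%:E)%E.
Proof. by []. Qed.

Lemma spec_integral_diag phi u :
  spec_integral E phi u u = (\int[spec_pos u u]_(x in D) (phi x)%:E)%E.
Proof.
rewrite spec_integralE [X in (_ - X)%E](_ : _ = 0%E) ?sube0//.
rewrite (eq_measure_integral mzero) ?integral_measure_zero// => A mA _.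
exact: spec_neg_diag.
Qed.

Import HBNNSimple.

Definition spec_simple (h : {nnsfun measurableTypeR R >-> R}) u : L2 mu :=
  \sum_(x \in range h) x *: E (h @^-1` [set x]) u.

Lemma l2dot_spec_simple (m : {measure set (measurableTypeR R) -> \bar R}) h u g :
  (forall A, measurable A -> m A = (l2dot (E A u) g)%:E) ->
  (l2dot (spec_simple h u) g)%:E = (\int[m]_x (h x)%:E)%E.
Proof.
move=> mE; rewrite integralT_nnsfun sintegralE /spec_simple.
rewrite fsbig_finite//= fsbig_finite//=.
elim/big_rec2: _ => [|x y v _ <-]; first by rewrite l2dot0l.
by rewrite l2dotDl l2dotZl mE.
Qed.

(** The isometry of the calculus on simple functions. The measure <E(A) u, k(-L) u> has density k
    against <E(A) u, u>; this is in turn the pairing of k(-L) u with E(A) u, whose measure <E(B) u,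
    E(A) u> has density the indicator of A. *)
Lemma l2dot_spec_simple2 h k u :
  (l2dot (spec_simple h u) (spec_simple k u))%:E =
  (\int[spec_pos u u]_x (h x * k x)%:E)%E.
Proof.
have k0 x : 0 <= k x by [].
have mk : measurable_fun setT k by [].
rewrite (@l2dot_spec_simple (density_measure (spec_pos u u) mk k0)).
  rewrite integral_density//; last exact/measurable_EFinP.
  by move=> x; rewrite lee_fin.
move=> A mA; rewrite l2dotC.
have mi : measurable_fun setT (\1_A : measurableTypeR R -> R) by [].
have i0 x : 0 <= (\1_A x : R) by [].
rewrite (@l2dot_spec_simple (density_measure (spec_pos u u) mi i0)); last first.
  move=> B mB; rewrite /= /density_measure integral_indic// setIC.
  rewrite [RHS](_ : _ = (l2dot (E (B `&` A) u) u)%:E); last by rewrite spec_setIl.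
  by rewrite -spec_pos_diag//; exact: measurableI.
rewrite integral_density//; last exact/measurable_EFinP.
by rewrite /= /density_measure integral_mkcond epatch_indic.
Qed.

(** The vector is the weak limit of h_n(-L) u for simple h_n increasing to phi. Finiteness of the
    two integrals is part of the conclusion: each is identified with a pairing of the limit
    vector. *)
Lemma func_calc_ex (phi : measurableTypeR R -> R) u :
  measurable_fun setT phi -> (forall x, 0 <= phi x) ->
  (\int[spec_pos u u]_x (phi x ^+ 2)%:E < +oo)%E ->
  exists v, forall g,
  [/\ (\int[spec_pos u g]_x (phi x)%:E < +oo)%E,
      (\int[spec_neg u g]_x (phi x)%:E < +oo)%E &
      (l2dot v g)%:E = (\int[spec_pos u g]_x (phi x)%:E
                        - \int[spec_neg u g]_x (phi x)%:E)%E].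
Proof.
move=> mphi phi0 phi2.
have mphiE : measurable_fun setT (EFin \o phi) by exact/measurable_EFinP.
pose h := nnsfun_approx measurableT mphiE.
have h0 n x : 0 <= h n x by [].
have hphi x : (h n x)%:E @[n --> \oo] --> (phi x)%:E.
  by apply: cvg_nnsfun_approx => // y _; rewrite lee_fin.
have ndh m n x : (m <= n)%N -> h m x <= h n x.
  by move=> mn; exact/lefP/nd_nnsfun_approx.
have h_le n x : h n x <= phi x.
  rewrite -lee_fin -(cvg_lim _ (hphi x))//.
  apply: lime_ge; first by apply/cvg_ex; eexists; exact: hphi.
  by exists n => // m /= nm; rewrite lee_fin ndh.
(* Since h is monotone, |v_n - v_m|^2 <= |v_n|^2 - |v_m|^2 for m <= n, and the
   norms are bounded by the integral of phi^2. *)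
pose v_ n := spec_simple (h n) u.
pose a n := l2dot (v_ n) (v_ n).
have aE n : (a n)%:E = (\int[spec_pos u u]_x (h n x * h n x)%:E)%E.
  exact: l2dot_spec_simple2.
have mhh m n : measurable_fun setT (fun x => (h m x * h n x)%:E).
  exact/measurable_EFinP/measurable_funM.
have a_le n : a n <= fine (\int[spec_pos u u]_x (phi x ^+ 2)%:E)%E.
  have I0 : (\int[spec_pos u u]_x (phi x ^+ 2)%:E)%E \is a fin_num.
    rewrite ge0_fin_numE//; apply: integral_ge0 => x _.
    by rewrite lee_fin sqr_ge0.
  rewrite -lee_fin (fineK I0) aE; apply: ge0_le_integral => //.
  - by move=> x _; rewrite lee_fin mulr_ge0.
  - exact/measurable_EFinP/measurable_funX.
  - by move=> x _; rewrite lee_fin expr2 ler_pM.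
have dv m n : (m <= n)%N -> l2dot (v_ n - v_ m) (v_ n - v_ m) <= a n - a m.
  move=> mn; have : a m <= l2dot (v_ n) (v_ m).
    rewrite -lee_fin aE l2dot_spec_simple2; apply: ge0_le_integral => //.
    - by move=> x _; rewrite lee_fin mulr_ge0.
    - by move=> x _; rewrite lee_fin ler_wpM2r// ndh.
  by rewrite l2dotBl !l2dotBr -/(a n) -/(a m) (l2dotC (v_ m)); lra.
have nda : nondecreasing_seq a.
  by move=> m n mn; rewrite -subr_ge0 (le_trans (l2dot_ge0 _) (dv _ _ mn)).
have ca : cvgn a.
  by apply: nondecreasing_is_cvgn => //; eexists; move=> _ [n _ <-]; exact: a_le.
have [|v vP] := @l2_weak_complete _ _ _ mu v_.
  move=> e e0; have /cvgrPdist_lt/(_ _ e0) [N _ NP] := ca.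
  have al n : a n <= limn a by exact: nondecreasing_cvgn_le.
  have aN : limn a < a N + e.
    by have := NP N (leqnn _); rewrite ger0_norm ?subr_ge0//; lra.
  have key m n : (N <= m)%N -> (N <= n)%N -> (m <= n)%N ->
      l2dot (v_ n - v_ m) (v_ n - v_ m) < e.
    move=> Nm _ mn; apply: le_lt_trans (dv _ _ mn) _.
    by have := al n; have := nda _ _ Nm; lra.
  exists N => m n Nm Nn; have [mn|/ltnW nm] := leqP n m; first exact: key.
  by rewrite -opprB l2dotNl l2dotC l2dotNl opprK; exact: key.
exists v => g; have [gp [gn [posE negE gE]]] := spec_jordan u g.
(* [spec_jordan] makes both parts of the charge positive measures of the form required here, so
   monotone convergence applies to each of them with no cancellation. *)
have key (m : {measure set (measurableTypeR R) -> \bar R}) g' :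
    (forall A, measurable A -> m A = (l2dot (E A u) g')%:E) ->
    (\int[m]_x (phi x)%:E = (l2dot v g')%:E)%E.
  move=> mE; have c1 : (l2dot (v_ n) g')%:E @[n --> \oo] --> (l2dot v g')%:E.
    by apply: cvg_EFin; [exact: nearW|exact: vP].
  rewrite -(cvg_lim _ c1)//.
  under [in RHS]eq_fun do rewrite (l2dot_spec_simple _ mE).
  rewrite -monotone_convergence//.
  - by apply: eq_integral => x _; exact/esym/cvg_lim.
  - by move=> n; exact/measurable_EFinP.
  - by move=> n x _; rewrite lee_fin.
  - by move=> x _ m' n' mn; rewrite lee_fin ndh.
by rewrite !(key _ _ posE) !(key _ _ negE) gE !ltry.
Qed.

End functional_calculus.

(** * Vectors phi(-L) u, their pairings and their composition *)

Section spectral_representation.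
Context d {T : measurableType d} {R : realType}.
Context {mu : {measure set T -> \bar R}}.
Variable E : spectralMeasure mu.
Implicit Types (u v g : L2 mu) (phi psi : measurableTypeR R -> R).

Local Notation D := (`[(0:R), +oo[%classic : set (measurableTypeR R)).

(* v is phi(-L) u: the pairings of v determine it up to almost-everywhere
   equality, and the finiteness rules out the junk value of +oo - +oo. *)
Definition spec_rep phi u v := forall g,
  [/\ (\int[spec_pos E u g]_(x in D) (phi x)%:E < +oo)%E,
      (\int[spec_neg E u g]_(x in D) (phi x)%:E < +oo)%E &
      (l2dot v g)%:E = spec_integral E phi u g].

Let mD : measurable D. Proof. exact: measurable_itv. Qed.

Let patch_ge0 phi : (forall x, D x -> 0 <= phi x) ->
  forall x, 0 <= (phi \_ D) x.
Proof.
by move=> phi0 x; rewrite patchE; case: ifPn => // /[!inE]; exact: phi0.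
Qed.

Let mpatch phi : measurable_fun setT phi -> measurable_fun setT (phi \_ D).
Proof.
by move=> mphi; apply/(measurable_restrictT _ mD)/measurable_funTS.
Qed.

Let EFin_patch phi : (fun x => (phi x)%:E) \_ D = (fun x => ((phi \_ D) x)%:E).
Proof. by apply/funext => x; rewrite !patchE; case: ifPn. Qed.

Lemma spec_rep_ex phi u : measurable_fun setT phi ->
  (forall x, D x -> 0 <= phi x) ->
  (\int[spec_pos E u u]_(x in D) (phi x ^+ 2)%:E < +oo)%E ->
  exists v, spec_rep phi u v.
Proof.
move=> mphi phi0 phi2.
have [|v vP] := @func_calc_ex _ _ _ _ E _ u (mpatch mphi) (patch_ge0 phi0).
  move: phi2; rewrite integral_mkcond; congr (_ < _)%E.
  by apply: eq_integral => x _; rewrite !patchE; case: ifPn => // _; rewrite expr0n.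
exists v => g; have [h1 h2 h3] := vP g; rewrite spec_integralE.
by rewrite !(integral_mkcond D) !EFin_patch.
Qed.

Lemma spec_rep_bounded (M : R) phi u : measurable_fun setT phi ->
  (forall x, D x -> 0 <= phi x <= M) -> exists v, spec_rep phi u v.
Proof.
move=> mphi phiM; apply: spec_rep_ex => // [x /phiM/andP[]//|].
apply: (@le_lt_trans _ _ (\int[spec_pos E u u]_(x in D) (M ^+ 2)%:E)%E).
  apply: ge0_le_integral => //.
  - by move=> x _; rewrite lee_fin sqr_ge0.
  - exact/measurable_EFinP/measurable_funX/measurable_funTS.
  - move=> x Dx; rewrite lee_fin; have /andP[p0 pM] := phiM _ Dx.
    by rewrite lerXn2r// nnegrE (le_trans p0).
by rewrite integral_cst// lte_mul_pinfty// ?lee_fin ?sqr_ge0// ltey_eq fin_num_measure.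
Qed.

(** [func_calc] selects a vector by its pairings, so the existence of one representing vector
    excludes the default value 0. *)
Lemma spec_rep_calc phi u v : spec_rep phi u v ->
  spec_rep phi u (func_calc E phi u).
Proof.
move=> rv; suff e : forall g, (l2dot (func_calc E phi u) g)%:E = spec_integral E phi u g.
  by move=> g; have [? ? _] := rv g.
apply: (@xgetPex _ 0 [set v | forall g, (l2dot v g)%:E = spec_integral E phi u g]).
by exists v => g; have [] := rv g.
Qed.

(** The charge <E(B) a, b> has the indicator of A as density against <E(B) u, g>. With a = u and b =
    E(A) g this makes A |-> <phi(-L) u, E(A) g> the indefinite integral of phi. *)
Lemma spec_integral_restr phi u g a b A : measurable A ->
  measurable_fun setT phi -> (forall x, D x -> 0 <= phi x) ->
  (\int[spec_pos E u g]_(x in D) (phi x)%:E < +oo)%E ->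
  (\int[spec_neg E u g]_(x in D) (phi x)%:E < +oo)%E ->
  (forall B, measurable B -> l2dot (E B a) b = l2dot (E (B `&` A) u) g) ->
  spec_integral E phi a b = (\int[spec_pos E u g]_(x in A) ((phi \_ D) x)%:E
    - \int[spec_neg E u g]_(x in A) ((phi \_ D) x)%:E)%E.
Proof.
move=> mA mphi phi0 py ny abE.
have mp := mpatch mphi; have p0 := patch_ge0 phi0.
have mi : measurable_fun setT (\1_A : measurableTypeR R -> R) by [].
have i0 x : 0 <= (\1_A x : R) by [].
have iE (m : {measure set (measurableTypeR R) -> \bar R}) :
    (\int[m]_x (((phi \_ D) x)%:E * (\1_A x)%:E) =
     \int[m]_(x in A) ((phi \_ D) x)%:E)%E.
  by rewrite [RHS]integral_mkcond epatch_indic.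
have i1 (m : {measure set (measurableTypeR R) -> \bar R}) B : measurable B ->
    (\int[m]_(x in B) (\1_A x)%:E = m (B `&` A))%E.
  by move=> mB; rewrite integral_indic// setIC.
have iy (m : {finite_measure set (measurableTypeR R) -> \bar R}) :
    (\int[m]_x (\1_A x)%:E < +oo)%E.
  by rewrite i1// ltey_eq fin_num_measure//; exact: measurableI.
have fy (m : {measure set (measurableTypeR R) -> \bar R}) :
    (\int[m]_(x in D) (phi x)%:E < +oo)%E ->
    (\int[m]_x (((phi \_ D) x)%:E * (\1_A x)%:E) < +oo)%E.
  move=> my; rewrite iE; apply: le_lt_trans my.
  rewrite [leRHS]integral_mkcond EFin_patch.
  apply: ge0_subset_integral => //; first exact/measurable_EFinP.
  by move=> x _; rewrite lee_fin.
rewrite /spec_integral /charge_integral !(integral_mkcond D) !EFin_patch.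
have nuE B : measurable B -> spec_charge E a b B =
    (\int[spec_pos E u g]_(x in B) (\1_A x)%:E -
     \int[spec_neg E u g]_(x in B) (\1_A x)%:E)%E.
  move=> mB; rewrite !i1//= /spec_charge abE//.
  have [gp [gn [posE negE gE]]] := spec_jordan E u g.
  have mBA := measurableI _ _ mB mA.
  by rewrite posE// negE// gE.
have mpE : measurable_fun setT (fun x => ((phi \_ D) x)%:E).
  exact/measurable_EFinP.
by have [_ _] := @charge_integral_density _ _ _ (spec_charge E a b)
  (spec_pos E u g) (spec_neg E u g) _ (fun x => ((phi \_ D) x)%:E)
  mi i0 (iy _) (iy _) nuE p0 mpE (fy _ py) (fy _ ny); rewrite !iE.
Qed.

(** If v = phi(-L) u then dE_{v,g} = phi dE_{u,g}, whence psi(-L) phi(-L) = (psi phi)(-L). The pair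
    (a, b) need only induce the same charge as (v, g), so that (g, v) is allowed as well. *)
Lemma spec_integral_comp phi psi u v g a b :
  measurable_fun setT phi -> (forall x, D x -> 0 <= phi x) ->
  measurable_fun setT psi -> (forall x, D x -> 0 <= psi x) ->
  spec_rep phi u v ->
  (\int[spec_pos E u g]_(x in D) (psi x * phi x)%:E < +oo)%E ->
  (\int[spec_neg E u g]_(x in D) (psi x * phi x)%:E < +oo)%E ->
  (forall A, measurable A -> l2dot (E A a) b = l2dot (E A v) g) ->
  [/\ (\int[spec_pos E a b]_(x in D) (psi x)%:E < +oo)%E,
      (\int[spec_neg E a b]_(x in D) (psi x)%:E < +oo)%E &
      spec_integral E psi a b = spec_integral E (psi \* phi)%R u g].
Proof.
move=> mphi phi0 mpsi psi0 rv py ny abE.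
have mp := mpatch mphi; have p0 := patch_ge0 phi0.
have mq := mpatch mpsi; have q0 := patch_ge0 psi0.
have [ry rny rE] := rv g.
have pqE : (fun x => (((psi \_ D) x)%:E * ((phi \_ D) x)%:E)%E) =
    (fun x => (psi x * phi x)%:E) \_ D.
  by apply/funext => x; rewrite !patchE; case: ifPn => _; rewrite ?mule0.
have nuE A : measurable A -> spec_charge E a b A =
    (\int[spec_pos E u g]_(x in A) ((phi \_ D) x)%:E -
     \int[spec_neg E u g]_(x in A) ((phi \_ D) x)%:E)%E.
  move=> mA; rewrite /= /spec_charge abE// spec_sym//.
  have [_ _ ->] := rv (E A g).
  by apply: spec_integral_restr => // B mB; rewrite spec_setIl.
have {}ry : (\int[spec_pos E u g]_x ((phi \_ D) x)%:E < +oo)%E.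
  by move: ry; rewrite integral_mkcond EFin_patch.
have {}rny : (\int[spec_neg E u g]_x ((phi \_ D) x)%:E < +oo)%E.
  by move: rny; rewrite integral_mkcond EFin_patch.
have mqE : measurable_fun setT (fun x => ((psi \_ D) x)%:E).
  exact/measurable_EFinP.
move: py ny; rewrite !(integral_mkcond D) -!pqE => py ny.
have [h1 h2 h3] := @charge_integral_density _ _ _ (spec_charge E a b)
  (spec_pos E u g) (spec_neg E u g) _ (fun x => ((psi \_ D) x)%:E)
  mp p0 ry rny nuE q0 mqE py ny.
rewrite !spec_integralE !(integral_mkcond D) -pqE EFin_patch; split => //.
Qed.

End spectral_representation.

(** * The spectral calculus and the generator *)

Section generator_spectrum.
Context d {T : measurableType d} {R : realType}.
Context {mu : {measure set T -> \bar R}}.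
Variables (F : set (L2 mu)) (form : L2 mu -> L2 mu -> R).
Variables (E : spectralMeasure mu) (L : operator mu).
Hypothesis hL : generator F form E L.
Implicit Types (u v w g f : L2 mu) (phi : measurableTypeR R -> R).

Local Notation D := (`[(0:R), +oo[%classic : set (measurableTypeR R)).
Local Notation idR := (fun x : measurableTypeR R => x : R).

(** Membership in the domain is the finiteness of the integral of l^2 dE_{w,w}, which is what makes
    a representing vector exist. *)
Lemma generator_rep w : op_dom L w -> spec_rep E idR w (- L w).
Proof.
move=> Lw; have [_ [domE appE]] := generator_spectral hL.
have Lw' : op_dom (opN L) w by [].
move: (Lw'); rewrite domE /= spec_integral_diag => w2.
have [v rv] := @spec_rep_ex _ _ _ _ E idR w (@measurable_id _ _ setT)
  (fun x => ltac:(rewrite /= in_itv/= andbT; exact)) w2.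
move=> g; have [h1 h2 <-] := spec_rep_calc rv g; split => //.
by rewrite (eq_l2dotl _ (appE w Lw')).
Qed.

(* L is self-adjoint, so it suffices to test u against the domain of L. *)
Lemma generator_app phi f u v : measurable_fun setT phi ->
  (forall x, D x -> 0 <= phi x) -> spec_rep E phi f u ->
  spec_rep E (idR \* phi) f v -> op_dom L u /\ l2eq (L u) (- v).
Proof.
move=> mphi phi0 ru rv; have sL := generator_self_adjoint hL.
apply/(self_adjoint_graph sL) => w Lw.
have [_ _] := generator_rep Lw u.
have [h1 h2 h3] := rv w.
(* Symmetry of the projections gives dE_{w,u} = dE_{u,w} = phi dE_{f,w}, so <-L w, u> is the
   integral of l phi dE_{f,w}, that is <v, w>. *)
have [_ _ ->] := @spec_integral_comp _ _ _ _ E phi idR f u w w u mphi phi0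
  (@measurable_id _ _ setT) (fun x => ltac:(rewrite /= in_itv/= andbT; exact)) ru h1 h2
  (fun A mA => ltac:(by rewrite spec_sym// l2dotC)).
rewrite -h3 l2dotNl l2dotNr (l2dotC w) => -[<-].
by rewrite opprK.
Qed.

(** The vector h = E({0}) f lies in ker L, because l times the indicator of 0 is the zero
    multiplier. Hence |h|^2 = <f, h> = 0, and no spectral measure of f has an atom at 0. *)
Lemma orthogonal_kernel_spec0 f : (forall h, op_ker L h -> l2dot f h = 0) ->
  forall g, spec_pos E f g [set 0] = 0%E /\ spec_neg E f g [set 0] = 0%E.
Proof.
move=> fker.
have m0 : measurable ([set 0] : set (measurableTypeR R)) by exact: measurable_set1.
have D0 : ([set 0] : set (measurableTypeR R)) `&` D = [set 0].
  by apply/seteqP; split=> [x [] //|x /= ->]; split=> //; rewrite /= in_itv/= lexx.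
pose h := E [set 0] f.
have rh : spec_rep E \1_[set 0] f h.
  move=> g; have [gp [gn [posE negE gE]]] := spec_jordan E f g.
  rewrite spec_integralE !integral_indic//; try exact: measurable_itv.
  by rewrite D0 /= posE// negE// gE !ltry.
have r0 : spec_rep E (idR \* \1_[set 0]) f 0.
  move=> g.
  have i0 (m : {measure set (measurableTypeR R) -> \bar R}) :
      (\int[m]_(x in D) ((idR \* \1_[set 0]) x)%:E = 0)%E.
    apply: integral0_eq => x _ /=; rewrite indicE.
    by have [/[!inE]/= ->|_] := boolP (x \in _); rewrite ?mul0r ?mulr0.
  by rewrite spec_integralE !i0 l2dot0l sube0 ltry; split.
have mi : measurable_fun setT (\1_[set 0] : measurableTypeR R -> R) by [].
have [//|Lh Lh0] := generator_app mi _ rh r0.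
have h0 : l2eq h 0.
  apply: l2dot_eq0; rewrite /h -(spec_setIl E)// setIid l2dotC.
  by apply: fker; split; [exact: Lh|move: Lh0; rewrite oppr0].
move=> g; have [gp [gn [posE negE _]]] := spec_jordan E f g.
by rewrite posE// negE// !(eq_l2dotl _ h0) !l2dot0l.
Qed.

End generator_spectrum.

(** * Integrals over the positive half-line *)

Section positive_half_line.
Context {R : realType}.
Local Notation leb := (@lebesgue_measure R).
Local Notation Rpos := (`]0, +oo[%classic : set (measurableTypeR R)).
Implicit Types f h H : R -> R.

(** The inversion x |-> K / x maps [exhaustion 1 n] onto [exhaustion K n]. *)
Definition exhaustion (K : R) (n : nat) : set (measurableTypeR R) :=
  `[K / n.+1%:R, K * n.+1%:R]%classic.

Lemma measurable_exhaustion K n : measurable (exhaustion K n).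
Proof. exact: measurable_itv. Qed.

Lemma exhaustion_nd K : 0 < K -> nondecreasing_seq (exhaustion K).
Proof.
move=> K0 m n mn; apply/subsetPset/subset_itv; rewrite bnd_simp.
  by rewrite ler_pM2l// lef_pV2 ?posrE// ler_nat.
by rewrite ler_pM2l// ler_nat.
Qed.

Lemma exhaustion_gt0 K n x : 0 < K -> exhaustion K n x -> 0 < x.
Proof.
move=> K0; rewrite /exhaustion/= in_itv/= => /andP[+ _].
by apply: lt_le_trans; rewrite divr_gt0.
Qed.

Lemma exhaustion_near K x : 0 < K -> 0 < x ->
  \forall n \near \oo, exhaustion K n x.
Proof.
move=> K0 x0; near=> n; rewrite /exhaustion/= in_itv/=; apply/andP; split.
  rewrite ler_pdivrMr// mulrC -ler_pdivrMr//.
  rewrite (@le_trans _ _ n%:R)// ?ler_nat//.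
  by near: n; exact: nbhs_infty_ger.
rewrite mulrC -ler_pdivrMr// (@le_trans _ _ n%:R)// ?ler_nat//.
by near: n; exact: nbhs_infty_ger.
Unshelve. all: by end_near. Qed.

Lemma bigcup_exhaustion K : 0 < K -> \bigcup_n exhaustion K n = Rpos.
Proof.
move=> K0; apply/seteqP; split=> [x [n _ /(exhaustion_gt0 K0)]|x].
  by rewrite /= in_itv/= andbT.
rewrite /= in_itv/= andbT => /(exhaustion_near K0)[n _ /(_ n (leqnn _)) nx].
by exists n.
Qed.

Lemma cvg_exhaustion_ge0 K f : 0 < K -> measurable_fun Rpos f ->
  (forall x, 0 < x -> 0 <= f x) ->
  (\int[leb]_(x in exhaustion K n) (f x)%:E @[n --> \oo] -->
   \int[leb]_(x in Rpos) (f x)%:E)%E.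
Proof.
move=> K0 mf f0; rewrite -(bigcup_exhaustion K0).
apply: ge0_nondecreasing_set_cvg_integral.
- exact: exhaustion_nd.
- by move=> n; exact: measurable_exhaustion.
- move=> n; apply/measurable_EFinP; apply: measurable_funS mf => //.
  by move=> x /(exhaustion_gt0 K0) x0; rewrite /= in_itv/= x0.
- by move=> n x /(exhaustion_gt0 K0) x0; rewrite lee_fin f0.
Qed.

Lemma cvg_exhaustion K f : 0 < K -> leb.-integrable Rpos (EFin \o f) ->
  (\int[leb]_(x in exhaustion K n) (f x)%:E @[n --> \oo] -->
   \int[leb]_(x in Rpos) (f x)%:E)%E.
Proof.
move=> K0 intf; have mRpos : measurable Rpos by exact: measurable_itv.
have subR n : exhaustion K n `<=` Rpos.
  by move=> x /(exhaustion_gt0 K0) x0; rewrite /= in_itv/= x0.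
rewrite (_ : (fun n => _) = (fun n => \int[leb]_(x in Rpos)
    ((EFin \o f) \_ (exhaustion K n)) x)%E); last first.
  apply/funext => n; rewrite -integral_mkcondr; congr integral.
  by apply/esym/setIidPr.
have /measurable_EFinP mf := measurable_int _ intf.
have [] := @dominated_convergence _ _ _ leb Rpos mRpos
  (fun n => (EFin \o f) \_ (exhaustion K n)) (EFin \o f) (abse \o (EFin \o f)) => //.
- move=> n; apply: measurable_funTS.
  apply/(measurable_restrictT _ (measurable_exhaustion K n)).
  by apply/measurable_EFinP; exact: measurable_funS mf.
- exact/measurable_EFinP.
- apply: aeW => x; rewrite /= in_itv/= andbT => x0.
  apply: cvg_near_cst; apply: filterS (exhaustion_near K0 x0) => n nx.
  by rewrite patchE mem_set.
- exact: integrable_abse.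
- apply: aeW => x n _; rewrite patchE; case: ifPn => _; first exact: lexx.
  by rewrite abse0; exact: abse_ge0.
Qed.

(** The substitution x |-> K / x is made on the compact intervals of the exhaustion; since both
    integrands are nonnegative, the limits exist with no integrability assumption. *)
Lemma integral_inversion (K : R) f : 0 < K ->
  {in Rpos, continuous f} -> (forall x, 0 < x -> 0 <= f x) ->
  (\int[leb]_(x in Rpos) (f x)%:E =
   \int[leb]_(x in Rpos) (f (K / x) * (K / x ^+ 2))%:E)%E.
Proof.
move=> K0 cf f0.
have mRpos : measurable Rpos by exact: measurable_itv.
have oRpos : open (Rpos : set R) by exact: interval_open.
have RposE (x : R) : (x \in Rpos) = (0 < x).
  by apply/idP/idP; rewrite inE/= in_itv/= andbT.
pose F (x : R) : R := K / x.
have dF (x : R) : 0 < x -> is_derive x 1 F (- K / x ^+ 2).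
  move=> x0; have x_neq0 : x != 0 by rewrite gt_eqF.
  have h : is_derive x 1 (fun y : R => y^-1) (- x ^- 2 *: (1 : R)).
    exact: is_deriveV.
  have := is_deriveZ K h; rewrite (_ : _ \*: _ = F)//.
  by rewrite /GRing.scale/= mulr1 mulrN mulNr.
have F'E (x : R) : 0 < x -> (derive1 F) x = - K / x ^+ 2.
  by move=> x0; rewrite derive1E; have [_ ->] := dF x x0.
have cg (x : R) : 0 < x -> {for x, continuous (fun y : R => - K / y ^+ 2)}.
  move=> x0; apply: cvgM; first exact: cvg_cst.
  apply: cvgV; first by rewrite expf_neq0// gt_eqF.
  exact: exprn_continuous.
have cF' (x : R) : 0 < x -> {for x, continuous (derive1 F)}.
  move=> x0; rewrite /prop_for /continuous_at F'E//.
  apply: cvg_trans (cg _ x0); apply: near_eq_cvg; near=> y.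
  by rewrite F'E//; near: y; exact: lt_nbhsr.
have cF (x : R) : 0 < x -> {for x, continuous F}.
  by move=> x0; apply: cvgM; [exact: cvg_cst|apply: cvgV => //; rewrite gt_eqF].
pose g (x : R) := f (K / x) * (K / x ^+ 2).
have cg' : {in Rpos, continuous g}.
  move=> x; rewrite RposE => x0; apply: cvgM.
    apply: (@continuous_comp _ _ _ F f); first exact: cF.
    by apply: cf; rewrite RposE divr_gt0.
  apply: cvgM; first exact: cvg_cst.
  by apply: cvgV; [rewrite expf_neq0// gt_eqF|exact: exprn_continuous].
have c1 := cvg_exhaustion_ge0 K0 (open_continuous_measurable_fun oRpos cf) f0.
have c2 := cvg_exhaustion_ge0 ltr01 (open_continuous_measurable_fun oRpos cg').
rewrite -(cvg_lim _ c1)// -(cvg_lim _ (c2 _))//; last first.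
  by move=> x x0; rewrite /g mulr_ge0 ?f0 ?divr_ge0 ?divr_gt0 ?sqr_ge0// ltW.
congr (lim (_ @ \oo)%classic); apply/funext => n.
have n0 : (0 : R) < n.+1%:R by [].
have pos (x : R) : n.+1%:R^-1 <= x -> 0 < x by apply: lt_le_trans; rewrite invr_gt0.
rewrite /exhaustion mul1r mul1r.
have Fa : F n.+1%:R^-1 = K * n.+1%:R by rewrite /F invrK.
rewrite -[K / _]/(F n.+1%:R) -Fa.
rewrite (@integration_by_substitution_decreasing R F f).
- apply: eq_integral => x; rewrite inE/= in_itv/= => /andP[/pos x0 _].
  by congr EFin; rewrite /g !fctE F'E// mulNr opprK.
- by rewrite (@le_trans _ _ 1)// ?invf_le1 ?ler1n.
- move=> x y; rewrite !in_itv/= => /andP[/pos x0 _] /andP[/pos y0 _] xy.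
  by rewrite /F ltr_pM2l// ltf_pV2.
- by move=> x; rewrite in_itv/= => /andP[/ltW/pos x0 _]; exact: cF'.
- apply/cvg_ex; exists ((derive1 F) n.+1%:R^-1); apply: cvg_at_right_filter; exact: cF'.
- apply/cvg_ex; exists ((derive1 F) n.+1%:R); apply: cvg_at_left_filter; exact: cF'.
- split.
  + by move=> x; rewrite in_itv/= => /andP[/ltW/pos x0 _]; have [] := dF _ x0.
  + by apply: cvg_at_right_filter; exact: cF.
  + by apply: cvg_at_left_filter; exact: cF.
- apply: continuous_in_subspaceT => x; rewrite inE/= in_itv/= => /andP[Kx _].
  by apply: cf; rewrite RposE; apply: lt_le_trans Kx; rewrite divr_gt0.
Unshelve. all: by end_near. Qed.

(** The fundamental theorem of calculus on [1/(n+1), n+1]. Integrability of h identifies the limit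
    along this one exhaustion with the integral, so H is needed only along the two sequences of
    endpoints. *)
Lemma integral_total_derivative H h :
  (forall x : R, 0 < x -> is_derive x 1 H (h x)) -> {in Rpos, continuous h} ->
  leb.-integrable Rpos (EFin \o h) ->
  H n.+1%:R^-1 @[n --> \oo] --> 0 -> H n.+1%:R @[n --> \oo] --> 0 ->
  (\int[leb]_(x in Rpos) (h x) = 0)%R.
Proof.
move=> dH ch inth H0 Hy; have c := cvg_exhaustion ltr01 inth.
suff e : (\int[leb]_(x in exhaustion 1 n) (h x)%:E)%E @[n --> \oo] --> 0%E.
  by rewrite /Rintegral -(cvg_lim _ c)// (cvg_lim _ e).
have RposE (x : R) : (x \in Rpos) = (0 < x).
  by apply/idP/idP; rewrite inE/= in_itv/= andbT.
apply: (@cvg_trans _ ((H n.+1%:R)%:E - (H n.+1%:R^-1)%:E @[n --> \oo])%E); last first.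
  have := cvgB Hy H0; rewrite subrr => cB.
  apply: cvg_EFin; first exact: nearW.
  exact: cB.
apply: near_eq_cvg; near=> n; rewrite /exhaustion mul1r mul1r; apply/esym.
have pos (x : R) : n.+1%:R^-1 <= x -> 0 < x by apply: lt_le_trans; rewrite invr_gt0.
have cH (x : R) : 0 < x -> {for x, continuous H}.
  move=> x0; have [dx _] := dH _ x0.
  exact/differentiable_continuous/derivable1_diffP.
apply: continuous_FTC2.
- rewrite (@lt_trans _ _ 1)// ?invf_lt1// ?ltr1n//; near: n; exists 1%N => //.
- apply: continuous_in_subspaceT => x; rewrite inE/= in_itv/= => /andP[/pos x0 _].
  by apply: ch; rewrite RposE.
- split.
  + by move=> x; rewrite in_itv/= => /andP[/ltW/pos x0 _]; have [] := dH _ x0.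
  + by apply: cvg_at_right_filter; exact: cH.
  + by apply: cvg_at_left_filter; exact: cH.
- move=> x; rewrite in_itv/= => /andP[/ltW/pos x0 _].
  by rewrite derive1E; have [_ ->] := dH _ x0.
Unshelve. all: by end_near. Qed.

End positive_half_line.

(** * Integrability of the Gamma weight *)

Section gamma_integral.
Context {R : realType}.
Local Notation leb := (@lebesgue_measure R).
Local Notation Rpos := (`]0, +oo[%classic : set (measurableTypeR R)).
Variable s : R.
Hypothesis s01 : 0 < s < 1.

Let s0 : 0 < s. Proof. by case/andP: s01. Qed.
Let s1 : s < 1. Proof. by case/andP: s01. Qed.

Definition gamma_weight (r : R) : R := r `^ (s - 1) * expR (- r).

Lemma gamma_weight_ge0 r : 0 <= gamma_weight r.
Proof. by rewrite mulr_ge0 ?powR_ge0 ?expR_ge0. Qed.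

Lemma measurable_gamma_weight (A : set (measurableTypeR R)) :
  measurable_fun A gamma_weight.
Proof.
apply: measurable_funTS; apply: measurable_funM.
  exact: measurable_powR.
by apply: measurableT_comp; [exact: measurable_expR|exact: measurable_funN].
Qed.

Lemma continuous_powR_gt0 (p x : R) : 0 < x ->
  {for x, continuous (fun y : R => y `^ p)}.
Proof.
move=> x0; have [dx _] := is_derive1_powR p x0.
exact/differentiable_continuous/derivable1_diffP.
Qed.

(* (t / (1 + t)) ^ s is bounded and its derivative dominates the weight. *)
Lemma gamma_weight_integrable :
  leb.-integrable Rpos (EFin \o gamma_weight).
Proof.
have mRpos : measurable Rpos by exact: measurable_itv.
have oRpos : open (Rpos : set R) by exact: interval_open.
have RposE (x : R) : (x \in Rpos) = (0 < x).
  by apply/idP/idP; rewrite inE/= in_itv/= andbT.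
pose G (t : R) := (1 - (1 + t)^-1) `^ s.
pose g (t : R) := s * (1 - (1 + t)^-1) `^ (s - 1) * (1 + t) ^- 2.
have u0 (t : R) : 0 < t -> 0 < 1 - (1 + t)^-1.
  by move=> t0; rewrite subr_gt0 invf_lt1 ?ltrDl// addr_gt0.
have dG (t : R) : 0 < t -> is_derive t 1 G (g t).
  move=> t0; have t1 : 1 + t != 0 by rewrite gt_eqF// addr_gt0.
  have d1 : is_derive t 1 (fun t : R => 1 - (1 + t)^-1) ((1 + t) ^- 2).
    have h0 : is_derive t (1 : R) (fun t : R => 1 + t) 1.
      have h : is_derive t (1 : R) (cst (1 : R) + id) (0 + 1) by exact: is_deriveD.
      by rewrite add0r in h.
    have h1 : is_derive t (1 : R) (fun t : R => (1 + t)^-1) (- (1 + t) ^- 2 *: (1 : R)).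
      exact: is_deriveV.
    have : is_derive t (1 : R) (cst (1 : R) - (fun t : R => (1 + t)^-1))
      (0 - (- (1 + t) ^- 2 *: (1 : R))) by exact: is_deriveB.
    by rewrite sub0r /GRing.scale/= mulr1 opprK.
  have d2 := is_derive1_powR s (u0 _ t0).
  have := @is_derive1_comp R (fun x => x `^ s) (fun t : R => 1 - (1 + t)^-1) t _ _ d2 d1.
  by [].
have g0 t : 0 < t -> 0 <= g t.
  by move=> t0; rewrite /g !mulr_ge0 ?powR_ge0 ?invr_ge0 ?sqr_ge0// ltW.
have cg : {in Rpos, continuous g}.
  move=> t; rewrite RposE => t0.
  have c1 : {for t, continuous (fun t : R => 1 - (1 + t)^-1)}.
    apply: cvgB; first exact: cvg_cst.
    by apply: cvgV; [rewrite gt_eqF// addr_gt0|apply: cvgD => //; exact: cvg_cst].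
  apply: cvgM; last first.
    apply: cvgV; first by rewrite expf_neq0// gt_eqF// addr_gt0.
    apply: (@continuous_comp _ _ _ (fun t : R => 1 + t) (fun x => x ^+ 2)).
      by apply: cvgD => //; exact: cvg_cst.
    exact: exprn_continuous.
  apply: cvgM; first exact: cvg_cst.
  apply: (@continuous_comp _ _ _ (fun t : R => 1 - (1 + t)^-1) (fun x => x `^ (s - 1))) => //.
  exact: continuous_powR_gt0 (u0 _ t0).
have mg := open_continuous_measurable_fun oRpos cg.
have G1 t : 0 < t -> 0 <= G t <= 1.
  move=> t0; have <- : (1 : R) `^ s = 1 by rewrite powR1.
  rewrite powR_ge0/= ge0_ler_powR ?nnegrE//.
  - exact: ltW.
  - exact/ltW/u0.
  - by rewrite gerBl// invr_ge0 addr_ge0// ltW.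
have ig : (\int[leb]_(x in Rpos) (g x)%:E <= 1)%E.
  rewrite -(cvg_lim _ (cvg_exhaustion_ge0 ltr01 mg g0))//.
  apply: lime_le.
    by apply/cvg_ex; eexists; exact: cvg_exhaustion_ge0.
  near=> n; rewrite /exhaustion mul1r mul1r.
  have pos (x : R) : n.+1%:R^-1 <= x -> 0 < x by apply: lt_le_trans; rewrite invr_gt0.
  have cG (x : R) : 0 < x -> {for x, continuous G}.
    move=> x0; have [dx _] := dG _ x0.
    exact/differentiable_continuous/derivable1_diffP.
  rewrite (@continuous_FTC2 _ g G).
  - rewrite -EFinB lee_fin.
    have /andP[a0 _] := G1 _ (pos _ (lexx _)).
    have /andP[_ b1] := G1 n.+1%:R (ltr0Sn _ _).
    by rewrite lerBlDr (le_trans b1)// lerDl.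
  - rewrite (@lt_trans _ _ 1)// ?invf_lt1// ?ltr1n//; near: n; exists 1%N => //.
  - apply: continuous_in_subspaceT => x; rewrite inE/= in_itv/= => /andP[/pos x0 _].
    by apply: cg; rewrite RposE.
  - split.
    + by move=> x; rewrite in_itv/= => /andP[/ltW/pos x0 _]; have [] := dG _ x0.
    + by apply: cvg_at_right_filter; exact: cG.
    + by apply: cvg_at_left_filter; exact: cG.
  - move=> x; rewrite in_itv/= => /andP[/ltW/pos x0 _].
    by rewrite derive1E; have [_ ->] := dG _ x0.
(* 1 / s cancels the factor s in g, and 4 comes from (1 + x)^2 <= 4 e^x; the remaining factor (1 +
   x)^(1 - s) is at least 1. *)
have intg : leb.-integrable Rpos (EFin \o (fun x => 4 / s * g x)).
  rewrite (_ : EFin \o _ = (fun x => (4 / s)%:E * (g x)%:E)%E); last first.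
    by apply/funext => x; rewrite /= EFinM.
  apply: integrableZl => //; apply/integrableP; split; first exact/measurable_EFinP.
  apply: le_lt_trans (ltry 1); apply: le_trans ig.
  rewrite le_eqVlt; apply/orP; left; apply/eqP; apply: eq_integral => x.
  by rewrite RposE => x0; rewrite /= ger0_norm// g0.
apply: le_integrable intg => //.
  by apply/measurable_EFinP; apply: measurable_gamma_weight.
move=> x; rewrite /= in_itv/= andbT => x0.
have gx0 : 0 <= 4 / s * g x by apply: mulr_ge0 (g0 _ x0); rewrite divr_ge0// ltW.
rewrite lee_fin (ger0_norm (gamma_weight_ge0 x)) (ger0_norm gx0) {gx0}.
rewrite /gamma_weight /g.
have x1 : 0 < 1 + x by rewrite addr_gt0.
have -> : 1 - (1 + x)^-1 = x * (1 + x)^-1 by field; rewrite gt_eqF.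
have x1V : 0 <= (1 + x)^-1 by rewrite invr_ge0 ltW.
rewrite (powRM _ (ltW x0) x1V).
have -> : 4 / s * (s * (x `^ (s - 1) * (1 + x)^-1 `^ (s - 1)) * (1 + x) ^- 2) =
  x `^ (s - 1) * ((1 + x)^-1 `^ (s - 1) * (4 * (1 + x) ^- 2)).
  by field; rewrite !gt_eqF.
rewrite ler_wpM2l ?powR_ge0//.
have h1 : 1 <= (1 + x)^-1 `^ (s - 1).
  rewrite -[leLHS](powRr0 (1 + x)^-1) ger_powR//; last by rewrite subr_le0 ltW.
  by rewrite invr_gt0 x1/= invf_le1// lerDl ltW.
(* From e^x >= 1 + x^2 / 2: the difference 4 + 2 x^2 - (1 + x)^2 equals (x - 1)^2 + 2. *)
have h2 : expR (- x) <= 4 * (1 + x) ^- 2.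
  rewrite expRN ler_pdivlMr ?exprn_gt0// mulrC ler_pdivrMr ?expR_gt0//.
  have := expR_ge1Dxn 1 (ltW x0); rewrite (_ : 2`! = 2)%N// => h.
  have := sqr_ge0 (x - 1); rewrite !expr2 in h *; lra.
rewrite (le_trans h2)// ler_peMl// mulr_ge0// invr_ge0 exprn_ge0// ltW//.
Unshelve. all: by end_near. Qed.

Lemma gammaR_gt0 : 0 < gammaR s.
Proof.
have mRpos : measurable Rpos by exact: measurable_itv.
have i0 : (0 <= \int[leb]_(x in Rpos) (gamma_weight x)%:E)%E.
  by apply: integral_ge0 => x _; rewrite lee_fin gamma_weight_ge0.
rewrite /gammaR -[X in _ < X]/(fine (\int[leb]_(x in Rpos) (gamma_weight x)%:E)).
rewrite fine_gt0// ltey_eq (integrable_fin_num mRpos gamma_weight_integrable) andbT.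
(* A lower bound of the weight on [1, 2], where r^(s-1) >= 1 / r >= 1/2 and e^-r >= e^-2. *)
pose c : R := 2^-1 * expR (- 2).
have c0 : 0 < c by rewrite mulr_gt0 ?expR_gt0.
have mI : measurable (`[1, 2]%classic : set (measurableTypeR R)) by exact: measurable_itv.
apply: (@lt_le_trans _ _ (\int[leb]_(x in `[1%R, 2%R]) c%:E)%E).
  rewrite integral_cst//= lebesgue_measure_itv/= lte_fin ltr1n/= -EFinB -EFinM lte_fin.
  by rewrite mulr_gt0// subr_gt0 ltr1n.
have mw (A : set (measurableTypeR R)) : measurable_fun A (EFin \o gamma_weight).
  by apply/measurable_EFinP; exact: measurable_gamma_weight.
apply: (@le_trans _ _ (\int[leb]_(x in `[1%R, 2%R]) (gamma_weight x)%:E)%E).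
  apply: ge0_le_integral => //.
  - by move=> x _; rewrite lee_fin ltW.
  - move=> x; rewrite /= in_itv/= => /andP[x1 x2]; rewrite lee_fin.
    have x0 : 0 < x by rewrite (lt_le_trans _ x1).
    rewrite /c /gamma_weight ler_pM ?invr_ge0 ?expR_ge0 ?ler_expR ?lerN2//.
    rewrite (@le_trans _ _ (x `^ (-1)))//.
      by rewrite (powR_inv1 (ltW x0)) lef_pV2 ?posrE.
    by rewrite ler_powR// lerBrDr addNr ltW.
apply: ge0_subset_integral => //.
- by move=> x _; rewrite lee_fin gamma_weight_ge0.
- move=> x; rewrite /= !in_itv/= andbT => /andP[x1 _].
  by rewrite (lt_le_trans _ x1).
Qed.

End gamma_integral.

(** * The multiplier and its differential equation *)

Section derive_under_integral.
Context {R : realType} d {Y : measurableType d} {m : {measure set Y -> \bar R}}.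
Variables (f f' : R -> Y -> R) (B : set Y) (a u v : R) (G : Y -> R).
Hypotheses (mB : measurable B) (Ia : u < a < v).
Hypothesis intf : forall x, u < x < v -> m.-integrable B (EFin \o f x).
Hypothesis df : forall x y, u < x < v -> B y ->
  is_derive x 1 (f ^~ y) (f' x y).
Hypotheses (G0 : forall y, 0 <= G y) (intG : m.-integrable B (EFin \o G)).
Hypothesis f'G : forall x y, u < x < v -> B y -> `|f' x y| <= G y.

Lemma is_derive_under_integral :
  is_derive a 1 (fun x => \int[m]_(y in B) f x y) (\int[m]_(y in B) f' a y).
Proof.
have IaE : `]u, v[%classic a by rewrite /= in_itv.
have d1E x y : `]u, v[%classic x -> B y -> partial1of2 f x y = f' x y.
  rewrite /= in_itv/= => xuv By; rewrite partial1of2E.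
  by have [_ ->] := df xuv By.
have intf' x : `]u, v[%classic x -> m.-integrable B (EFin \o f x).
  by rewrite /= in_itv/=; exact: intf.
have der x y : `]u, v[%classic x -> B y -> derivable (f ^~ y) x 1.
  by rewrite /= in_itv/= => xuv By; have [] := df xuv By.
have ub x y : `]u, v[%classic x -> B y -> `|partial1of2 f x y| <= G y.
  by move=> xuv By; rewrite d1E//; apply: f'G => //; move: xuv; rewrite /= in_itv.
split.
  exact: (derivable_under_integral mB IaE intf' der G0 intG ub).
rewrite -derive1E (differentiation_under_integral mB IaE intf' der G0 intG ub).
by apply: eq_Rintegral => y /[!inE] By; rewrite d1E.
Qed.

End derive_under_integral.

Section heat_kernels.
Context {R : realType}.
Implicit Types y q : R.

(* kernel1 and kernel2 are the derivatives of kernel0 in y.  Only q >= 0 matters: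
   the absolute value keeps them bounded on the whole line. *)
Definition kernel0 y q := expR (- (y ^+ 2 * `|q| / 4)).
Definition kernel1 y q := - (y * `|q| / 2) * kernel0 y q.
Definition kernel2 y q :=
  (y ^+ 2 * `|q| ^+ 2 / 4 - `|q| / 2) * kernel0 y q.

Let is_derive_ext (f g : R -> R) (x df dg : R) : is_derive x 1 f df ->
  f =1 g -> df = dg -> is_derive x 1 g dg.
Proof. by move=> h /funext <- <-. Qed.

Lemma is_derive_kernel0 y q : is_derive y 1 (kernel0 ^~ q) (kernel1 y q).
Proof.
have h0 : is_derive y (1 : R) (- (`|q| / 4) \*: (id * id : R -> R))
    (- (`|q| / 4) *: (y *: (1 : R) + y *: (1 : R))) by exact: is_deriveZ.
have h : is_derive y (1 : R) (fun z : R => - (z ^+ 2 * `|q| / 4)) (- (y * `|q| / 2)).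
  apply: is_derive_ext h0 _ _ => [z|].
    by rewrite -[LHS]/(- (`|q| / 4) * (z * z)); field.
  by rewrite /GRing.scale/=; field.
have := @is_derive1_comp R expR _ y _ _ (is_derive_expR _) h.
by rewrite /kernel1 mulrC.
Qed.

Lemma is_derive_kernel1 y q : is_derive y 1 (kernel1 ^~ q) (kernel2 y q).
Proof.
have h : is_derive y (1 : R) (- (`|q| / 2) \*: (id : R -> R)) (- (`|q| / 2) *: (1 : R)).
  exact: is_deriveZ.
have h1 := is_derive_kernel0 y q.
have h2 : is_derive y (1 : R) ((- (`|q| / 2) \*: (id : R -> R)) * kernel0 ^~ q)
  (((- (`|q| / 2) \*: (id : R -> R)) y) *: kernel1 y q + kernel0 y q *: (- (`|q| / 2) *: (1 : R))).
  exact: is_deriveM.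
apply: is_derive_ext h2 _ _ => [z|].
  by rewrite -[LHS]/(- (`|q| / 2) * z * kernel0 z q) /kernel1; field.
rewrite -[LHS]/(- (`|q| / 2) * y * kernel1 y q + kernel0 y q * (- (`|q| / 2) * 1)).
by rewrite /kernel2 /kernel1; field.
Qed.

Lemma kernel0_gt0 y q : 0 < kernel0 y q. Proof. exact: expR_gt0. Qed.

Lemma kernel0_le1 y q : kernel0 y q <= 1.
Proof.
by rewrite expR_le1 oppr_le0 divr_ge0// mulr_ge0 ?sqr_ge0.
Qed.

Lemma mulr_expRN_le1 (x : R) : 0 <= x -> x * expR (- x) <= 1.
Proof.
move=> x0; rewrite expRN ler_pdivrMr ?expR_gt0// mul1r.
by apply: le_trans (expR_ge1Dx x); rewrite lerDr.
Qed.

Lemma sqr_expRN_le2 (x : R) : 0 <= x -> x ^+ 2 * expR (- x) <= 2.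
Proof.
move=> x0; rewrite expRN ler_pdivrMr ?expR_gt0//.
by have := expR_ge1Dxn 1 x0; rewrite (_ : 2`! = 2)%N// => h; lra.
Qed.

Lemma mul_kernel0_le y q : 0 < y -> `|q| * kernel0 y q <= 4 / y ^+ 2.
Proof.
move=> y0; rewrite ler_pdivlMr ?exprn_gt0//.
have x0 : 0 <= y ^+ 2 * `|q| / 4 by rewrite divr_ge0// mulr_ge0 ?sqr_ge0.
have := mulr_expRN_le1 x0; rewrite -/(kernel0 y q); lra.
Qed.

Lemma kernel1_le y q : 0 < y -> `|kernel1 y q| <= 2 / y.
Proof.
move=> y0; rewrite /kernel1 mulNr normrN ger0_norm; last first.
  by rewrite mulr_ge0 ?expR_ge0// divr_ge0// mulr_ge0// ltW.
have := mul_kernel0_le q y0 => h.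
have -> : y * `|q| / 2 * kernel0 y q = y / 2 * (`|q| * kernel0 y q) by field.
apply: le_trans (ler_wpM2l _ h) _; first by rewrite divr_ge0// ltW.
by rewrite le_eqVlt; apply/orP; left; apply/eqP; field; rewrite gt_eqF.
Qed.

Lemma kernel2_le y q : 0 < y -> `|kernel2 y q| <= 10 / y ^+ 2.
Proof.
move=> y0; set x := y ^+ 2 * `|q| / 4.
have x0 : 0 <= x by rewrite divr_ge0// mulr_ge0 ?sqr_ge0.
(* With x^2 e^-x <= 2 and x e^-x <= 1, the constant is 10 = 4 * 2 + 2 * 1. *)
have -> : kernel2 y q = (4 * (x ^+ 2 * expR (- x)) - 2 * (x * expR (- x))) / y ^+ 2.
  by rewrite /kernel2 /kernel0 -/x /x; field; rewrite gt_eqF.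
have y2 : 0 <= y ^- 2 by rewrite invr_ge0 sqr_ge0.
rewrite normrM (ger0_norm y2) ler_wpM2r//.
have := sqr_expRN_le2 x0; have := mulr_expRN_le1 x0.
have : 0 <= x * expR (- x) by rewrite mulr_ge0 ?expR_ge0.
have : 0 <= x ^+ 2 * expR (- x) by rewrite mulr_ge0 ?expR_ge0 ?sqr_ge0.
by rewrite ler_norml; lra.
Qed.

Lemma measurable_kernel0 y : measurable_fun setT (kernel0 y).
Proof.
apply: measurableT_comp; first exact: measurable_expR.
by apply: measurable_funN; apply: measurable_funM => //; apply: measurable_funM.
Qed.

Lemma measurable_kernel1 y : measurable_fun setT (kernel1 y).
Proof.
apply: measurable_funM; last exact: measurable_kernel0.
by apply: measurable_funN; apply: measurable_funM => //; apply: measurable_funM.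
Qed.

Lemma measurable_kernel2 y : measurable_fun setT (kernel2 y).
Proof.
apply: measurable_funM; last exact: measurable_kernel0.
apply: measurable_funB; apply: measurable_funM => //.
by apply: measurable_funM => //; apply: measurable_funX.
Qed.

End heat_kernels.

Lemma measurable_invr {R : realType} :
  measurable_fun setT (fun x : R => x^-1).
Proof.
have m0 : measurable ([set 0] : set R) by exact: measurable_set1.
rewrite -(setvU [set 0]); apply/measurable_funU => //; first exact: measurableC.
split; last exact: measurable_fun_set1.
apply: open_continuous_measurable_fun.
  apply: closed_openC.
  exact/accessible_closed_set1/hausdorff_accessible/norm_hausdorff.
move=> x; rewrite inE/= => /eqP x0; exact: inv_continuous.
Qed.

Section real_integrable.
Context d {T : measurableType d} {R : realType} (m : {measure set T -> \bar R}).
Variables (B : set T) (mB : measurable B).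
Implicit Types (f g : T -> R).

Lemma integrable_EFinZ (c : R) f : m.-integrable B (EFin \o f) ->
  m.-integrable B (EFin \o (fun x => c * f x)).
Proof.
move=> fi; rewrite (_ : EFin \o _ = (fun x => c%:E * (f x)%:E)%E).
  exact: integrableZl fi.
by apply/funext => x; rewrite /= EFinM.
Qed.

Lemma integrable_EFinD f g : m.-integrable B (EFin \o f) ->
  m.-integrable B (EFin \o g) -> m.-integrable B (EFin \o (fun x => f x + g x)).
Proof. by move=> fi gi; exact: (integrableD mB fi gi). Qed.

Lemma integrable_EFinB f g : m.-integrable B (EFin \o f) ->
  m.-integrable B (EFin \o g) -> m.-integrable B (EFin \o (fun x => f x - g x)).
Proof. by move=> fi gi; exact: (integrableB mB fi gi). Qed.

End real_integrable.

(** * Averages of the kernels against the Gamma weight *)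

Section subordination.
Context {R : realType}.
Local Notation leb := (@lebesgue_measure R).
Local Notation Rpos := (`]0, +oo[%classic : set (measurableTypeR R)).
Local Notation D := (`[(0:R), +oo[%classic : set (measurableTypeR R)).
Variable s : R.
Hypothesis s01 : 0 < s < 1.
Local Notation w := (gamma_weight s).
Implicit Types (k : R -> R -> R) (y l M : R).

Let mRpos : measurable Rpos. Proof. exact: measurable_itv. Qed.
Let mD : measurable D. Proof. exact: measurable_itv. Qed.

(** For [kernel0] and l >= 0 this is Gamma(s) psi(y, l); [kernel1] and [kernel2] give its first two
    derivatives in y. *)
Definition gamma_avg k y (l : measurableTypeR R) : R :=
  (\int[leb]_(r in Rpos) (w r * k y (l / r)))%R.

Let measurable_scaled k y : measurable_fun setT (k y) ->
  measurable_fun setT (fun z : measurableTypeR R * measurableTypeR R => k y (z.1 / z.2)).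
Proof.
move=> mk; apply: measurableT_comp => //; apply: measurable_funM => //.
exact: (measurableT_comp measurable_invr).
Qed.

Lemma gamma_avg_integrable k y l M : measurable_fun setT (k y) ->
  (forall q, `|k y q| <= M) ->
  leb.-integrable Rpos (EFin \o (fun r => w r * k y (l / r))).
Proof.
move=> mk kM.
have iM : leb.-integrable Rpos (fun r => (M%:E * (w r)%:E)%E).
  exact: integrableZl (gamma_weight_integrable s01).
apply: le_integrable iM => //.
  apply/measurable_EFinP/measurable_funTS/measurable_funM.
    exact: measurable_gamma_weight.
  have /(measurableT_comp (measurable_scaled mk)) := @measurable_pair1 _ _ (measurableTypeR R) (measurableTypeR R) l.
  exact.
move=> r _; rewrite -EFinM /= lee_fin !normrM mulrC ler_wpM2r//.
by rewrite (le_trans (kM _))// ler_norm.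
Qed.

Lemma gamma_avg_le k y l M : measurable_fun setT (k y) ->
  (forall q, `|k y q| <= M) -> `|gamma_avg k y l| <= M * gammaR s.
Proof.
move=> mk kM; have ik := gamma_avg_integrable l mk kM.
apply: le_trans (le_normr_Rintegral mRpos ik) _.
rewrite /gammaR -RintegralZl//; last exact: gamma_weight_integrable.
apply: le_Rintegral => //.
- exact: integrable_norm.
- exact: integrable_EFinZ (gamma_weight_integrable s01).
- move=> r _; rewrite normrM ger0_norm ?gamma_weight_ge0// mulrC.
  by rewrite ler_wpM2r ?gamma_weight_ge0.
Qed.

(** Measurability of a partial integral is obtained from Tonelli, for nonnegative integrands; so k
    is shifted by its bound M and [M * gammaR s] is subtracted afterwards. *)
Lemma measurable_gamma_avg k y M : measurable_fun setT (k y) ->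
  (forall q, `|k y q| <= M) -> measurable_fun setT (gamma_avg k y).
Proof.
move=> mk kM.
pose f (z : measurableTypeR R * measurableTypeR R) : \bar R :=
  ((\1_Rpos z.2 : R) * (w z.2 * (k y (z.1 / z.2) + M)))%:E.
have kM0 q : 0 <= k y q + M by have := kM q; rewrite ler_norml; lra.
have f0 z : (0 <= f z)%E.
  by rewrite lee_fin mulr_ge0// mulr_ge0 ?gamma_weight_ge0.
have mf : measurable_fun setT f.
  apply/measurable_EFinP; apply: measurable_funM.
    by apply: (measurableT_comp (measurable_indic mRpos)).
  apply: measurable_funM.
    by apply: (measurableT_comp (f := w)) => //; exact: measurable_gamma_weight.
  by apply: measurable_funD => //; exact: measurable_scaled.
have mF := @measurable_fun_fubini_tonelli_F _ _ _ _ _ leb f mf f0.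
have -> : gamma_avg k y = (fun l => fine (fubini_F leb f l) - M * gammaR s).
  apply/funext => l; rewrite /fubini_F /f /=.
  have iM : leb.-integrable Rpos (EFin \o (fun r => M * w r)).
    exact: integrable_EFinZ (gamma_weight_integrable s01).
  rewrite [X in fine X - _](_ : _ =
    (\int[leb]_(r in Rpos) (w r * k y (l / r) + M * w r)%:E)%E); last first.
    rewrite [RHS]integral_mkcond epatch_indic; apply: eq_integral => r _.
    by rewrite /= -EFinM; congr EFin; ring.
  rewrite -[fine _]/(\int[leb]_(r in Rpos) (w r * k y (l / r) + M * w r))%R.
  rewrite RintegralD//; last exact: gamma_avg_integrable.
  rewrite RintegralZl//; last exact: gamma_weight_integrable.
  by rewrite addrK.
by apply: measurable_funB => //; apply: measurableT_comp.
Qed.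

Lemma is_derive_gamma_avg k k' y l M :
  (forall z, measurable_fun setT (k z)) -> (forall z, measurable_fun setT (k' z)) ->
  (forall z q : R, is_derive z 1 (k ^~ q) (k' z q)) -> 0 < y ->
  (forall z q, y / 2 < z -> `|k z q| <= M) ->
  (forall z q, y / 2 < z -> `|k' z q| <= M) ->
  is_derive y 1 (gamma_avg k ^~ l) (gamma_avg k' y l).
Proof.
move=> mk mk' dk y0 kM k'M.
have yy : y / 2 < y < y + 1 by rewrite ltr_pdivrMr// ltr_pMr// ltr1n ltrDl ltr01.
have M0 : 0 <= M by apply: le_trans (normr_ge0 _) (kM y 0 (andP yy).1).
apply: (@is_derive_under_integral R _ _ leb
  (fun z r => w r * k z (l / r)) (fun z r => w r * k' z (l / r))
  Rpos y (y / 2) (y + 1) (fun r => M * w r)) => //.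
- by move=> z /andP[z0 _]; apply: gamma_avg_integrable => // q; exact: kM.
- by move=> r; rewrite mulr_ge0// gamma_weight_ge0.
- exact: integrable_EFinZ (gamma_weight_integrable s01).
- move=> z r /andP[z0 _] _; rewrite normrM ger0_norm ?gamma_weight_ge0// mulrC.
  by rewrite ler_wpM2r ?gamma_weight_ge0// k'M.
Qed.

Section finite_measure.
Variable m : {finite_measure set (measurableTypeR R) -> \bar R}.

Lemma bounded_integrable (h : measurableTypeR R -> R) M : measurable_fun setT h ->
  (forall l, D l -> `|h l| <= M) -> m.-integrable D (EFin \o h).
Proof.
move=> mh hM; apply: (@le_integrable _ _ _ _ _ _ _ (cst M%:E)) => //.
- exact/measurable_EFinP/measurable_funTS.
- by move=> l Dl; rewrite /= lee_fin (le_trans (hM _ Dl))// ler_norm.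
- by apply: finite_measure_integrable_cst.
Qed.

(** Two differentiations under the integral are nested. The outer one moves z in ]y/2, y + 1[, and
    the inner one at z needs bounds beyond z / 2, hence the range above y / 4. The dominating
    function is constant, which is integrable for a finite measure. *)
Lemma is_derive_integral_gamma_avg k k' y M :
  (forall z, measurable_fun setT (k z)) -> (forall z, measurable_fun setT (k' z)) ->
  (forall z q : R, is_derive z 1 (k ^~ q) (k' z q)) -> 0 < y ->
  (forall z q, y / 4 < z -> `|k z q| <= M) ->
  (forall z q, y / 4 < z -> `|k' z q| <= M) ->
  is_derive y 1 (fun z => \int[m]_(l in D) gamma_avg k z l)
    (\int[m]_(l in D) gamma_avg k' y l).
Proof.
move=> mk mk' dk y0 kM k'M.
have yy : y / 2 < y < y + 1 by rewrite ltr_pdivrMr// ltr_pMr// ltr1n ltrDl ltr01.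
have y42 : y / 4 < y / 2 by lra.
have M0 : 0 <= M.
  by apply: le_trans (normr_ge0 _) (kM y 0 _); case/andP: yy => + _; apply: lt_trans.
apply: (@is_derive_under_integral R _ _ m (gamma_avg k) (gamma_avg k')
  D y (y / 2) (y + 1) (fun _ => M * gammaR s)) => //.
- move=> z /andP[z0 _]; have zM q : `|k z q| <= M by apply: kM; lra.
  apply: (@bounded_integrable _ (M * gammaR s)).
    exact: measurable_gamma_avg zM.
  by move=> l _; exact: gamma_avg_le.
- move=> z l /andP[z0 _] _; apply: (@is_derive_gamma_avg k k' z l M) => //.
  + by rewrite (lt_trans _ z0)// divr_gt0.
  + by move=> x q zx; apply: kM; lra.
  + by move=> x q zx; apply: k'M; lra.
- by move=> _; rewrite mulr_ge0// ltW// gammaR_gt0.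
- by apply: finite_measure_integrable_cst.
- move=> z l /andP[z0 _] _; have zM q : `|k' z q| <= M by apply: k'M; lra.
  exact: gamma_avg_le.
Qed.

(** [kernel0] is bounded by 1 and continuous in y through 0, with value 1 there. The one-sided limit
    is therefore a value: both integrals are continuous on ]-1, 1[ by domination. *)
Lemma cvg_integral_gamma_avg :
  \int[m]_(l in D) gamma_avg kernel0 y l @[y --> 0^'+] -->
  gammaR s * fine (m D).
Proof.
have ck0 q : continuous (kernel0 ^~ q : R -> R).
  move=> z; have [dz _] := is_derive_kernel0 z q.
  exact/differentiable_continuous/derivable1_diffP.
have k01 (z q : R) : `|kernel0 z q| <= 1 by rewrite ger0_norm ?kernel0_le1// ltW// kernel0_gt0.
have i0 : (0 : R) \in (`]-1, 1[%classic : set R).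
  by rewrite inE/= in_itv/= ltrN10 ltr01.
have cl l : {in (`]-1, 1[%classic : set R), continuous (gamma_avg kernel0 ^~ l)}.
  apply: (@continuity_under_integral R _ _ leb
      (fun z r => w r * kernel0 z (l / r)) Rpos mRpos (-1) 1 _ _ w).
  - by move=> z _; apply: gamma_avg_integrable (k01 z); exact: measurable_kernel0.
  - apply: aeW => r _ z _; apply: cvgM; first exact: cvg_cst.
    exact: ck0.
  - exact: gamma_weight_integrable.
  - move=> z _; apply: aeW => r _.
    by rewrite normrM ger0_norm ?gamma_weight_ge0// ler_piMr ?gamma_weight_ge0.
have := @continuity_under_integral R _ _ m (gamma_avg kernel0) D mD (-1) 1 _ _
  (fun=> gammaR s).
have iG : m.-integrable D (EFin \o (fun=> gammaR s)).
  exact: finite_measure_integrable_cst.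
have lG z l : `|gamma_avg kernel0 z l| <= gammaR s.
  rewrite -[leRHS]mul1r; apply: gamma_avg_le => //; exact: measurable_kernel0.
move=> /(_ _ _ iG) c.
have {c} /(_ 0) c : {in (`]-1, 1[%classic : set R), continuous
    (fun z => \int[m]_(l in D) gamma_avg kernel0 z l)}.
  apply: c.
  - move=> z _; apply: (@bounded_integrable _ (gammaR s)) => //.
    by apply: measurable_gamma_avg (k01 z); exact: measurable_kernel0.
  - by apply: aeW => l _; exact: cl.
  - by move=> z _; apply: aeW => l _.
have E0 : gammaR s * fine (m D) = \int[m]_(l in D) gamma_avg kernel0 0 l.
  transitivity (\int[m]_(l in D) cst (gammaR s) l).
    by rewrite (Rintegral_cst m mD).
  apply: eq_Rintegral => l _.
  rewrite /gammaR /gamma_avg; apply: eq_Rintegral => r _.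
  by rewrite /kernel0 expr0n/= !mul0r oppr0 expR0 mulr1.
rewrite E0; apply: cvg_at_right_filter; exact: c.
Qed.

End finite_measure.

(** With q = l / r the kernels combine into l ((s - 1) / r - 1 + z / r^2) [kernel0], where z = y^2 l
    / 4. The choice a = 1 - 2s is what produces the coefficient (s - 1) / r, making the bracket the
    logarithmic derivative of r^(s-1) e^(-r - z/r). The case l = 0 is apart because both derivative
    kernels vanish there and l is divided out below. *)
Lemma gamma_avg_ode a y l : a = 1 - 2 * s -> 0 < y -> 0 <= l ->
  gamma_avg kernel2 y l + a / y * gamma_avg kernel1 y l =
  l * gamma_avg kernel0 y l.
Proof.
move=> aE y0; rewrite le_eqVlt => /predU1P[<-|l0].
  have avg0 k : k y 0 = 0 -> gamma_avg k y 0 = 0.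
    move=> k0; transitivity (\int[leb]_(r in Rpos) (cst 0 r : R)).
      by apply: eq_Rintegral => r _; rewrite mul0r k0 mulr0.
    by rewrite (Rintegral_cst leb mRpos) mul0r.
  rewrite mul0r !avg0 ?mulr0 ?addr0//.
    by rewrite /kernel1 normr0 mulr0 mul0r oppr0 mul0r.
  by rewrite /kernel2 normr0 expr0n/= mulr0 !mul0r subrr mul0r.
pose z := y ^+ 2 * l / 4.
(* The difference of the two sides is l times the integral of the derivative of H. *)
pose H (r : R) := r `^ (s - 1) * expR (- r - z / r).
pose c1 := a / y.
pose h (r : R) := l^-1 * ((w r * kernel2 y (l / r) + c1 * (w r * kernel1 y (l / r)))
   - l * (w r * kernel0 y (l / r))).
have k0M q : `|kernel0 y q| <= 1 by rewrite ger0_norm ?kernel0_le1// ltW// kernel0_gt0.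
have i0 := gamma_avg_integrable l (measurable_kernel0 y) k0M.
have i1 := gamma_avg_integrable l (measurable_kernel1 y) (fun q => kernel1_le q y0).
have i2 := gamma_avg_integrable l (measurable_kernel2 y) (fun q => kernel2_le q y0).
have i21 := integrable_EFinD mRpos i2 (integrable_EFinZ mRpos c1 i1).
have i210 := integrable_EFinB mRpos i21 (integrable_EFinZ mRpos l i0).
have z0 : 0 < z by rewrite divr_gt0// mulr_gt0// exprn_gt0.
have cvg_harmonic_bound (C : R) (u : nat -> R) :
    (forall n, 0 <= u n <= C * n.+1%:R^-1) -> u n @[n --> \oo] --> 0.
  move=> uC; apply: (@squeeze_cvgr _ _ _ _ (cst 0) (fun n => C * n.+1%:R^-1)).
  - exact: nearW.
  - exact: cvg_cst.
  - by rewrite -(mulr0 C); apply: cvgMr; exact: cvg_harmonic.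
have H_ge0 r : 0 <= H r by rewrite mulr_ge0 ?powR_ge0 ?expR_ge0.
have dH (r : R) : 0 < r -> is_derive r 1 H (h r).
  move=> r0; have r_neq0 : r != 0 by rewrite gt_eqF.
  have d1 := is_derive1_powR (s - 1) r0.
  have d2 : is_derive r (1 : R) (fun x : R => x^-1) (- r ^- 2 *: (1 : R)).
    exact: is_deriveV.
  have d3 : is_derive r (1 : R) ((-%R : R -> R) - z \*: (fun x : R => x^-1))
    (-1 - z *: (- r ^- 2 *: (1 : R))) by exact: is_deriveB.
  have d4 := @is_derive1_comp R expR _ r _ _ (is_derive_expR _) d3.
  have d5 := @is_deriveM _ _ (fun x : R => x `^ (s - 1)) _ r (1 : R) _ _ d1 d4.
  have d6 : is_derive r 1 H (r `^ (s - 1) * (expR (- r - z / r) *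
      (-1 - z * (- r ^- 2 * 1))) + expR (- r - z / r) *
      ((s - 1) * r `^ (s - 1 - 1))) := d5.
  rewrite (_ : h r = (r `^ (s - 1) * (expR (- r - z / r) *
      (-1 - z * (- r ^- 2 * 1))) + expR (- r - z / r) *
      ((s - 1) * r `^ (s - 1 - 1))))//.
  rewrite [r `^ (s - 1 - 1)]powRB ?r_neq0 ?implybT// powRr1 ?(ltW r0)//.
  rewrite /h /kernel2 /kernel1 /kernel0 /gamma_weight ger0_norm; last first.
    by rewrite divr_ge0// ltW.
  rewrite (_ : y ^+ 2 * (l / r) / 4 = z / r); last by rewrite /z; field.
  rewrite expRD /c1 aE /z; move: (expR _) (expR _) (r `^ _) => e1 e2 p.
  by field; rewrite !gt_eqF.
have ck0 : continuous (kernel0 y : R -> R).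
  move=> q; apply: (@continuous_comp _ _ _ (fun q => - (y ^+ 2 * `|q| / 4)) expR).
    apply: cvgN; apply: cvgM; last exact: cvg_cst.
    by apply: cvgM; [exact: cvg_cst|exact: norm_continuous].
  exact: continuous_expR.
have ck1 : continuous (kernel1 y : R -> R).
  move=> q; apply: cvgM; last exact: ck0.
  apply: cvgN; apply: cvgM; last exact: cvg_cst.
  by apply: cvgM; [exact: cvg_cst|exact: norm_continuous].
have ck2 : continuous (kernel2 y : R -> R).
  move=> q; apply: cvgM; last exact: ck0.
  apply: cvgB; apply: cvgM; [|exact: cvg_cst|exact: norm_continuous|exact: cvg_cst].
  apply: cvgM; first exact: cvg_cst.
  apply: (@continuous_comp _ _ _ (fun q : R => `|q|) (fun x => x ^+ 2)).
    exact: norm_continuous.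
  exact: exprn_continuous.
have ch : {in Rpos, continuous h}.
  move=> r; rewrite inE/= in_itv/= andbT => r0.
  have cw : {for r, continuous (w : R -> R)}.
    apply: cvgM; first exact: continuous_powR_gt0.
    apply: (@continuous_comp _ _ _ (fun r : R => - r) expR).
      exact: oppr_continuous.
    exact: continuous_expR.
  have cq : {for r, continuous (fun r : R => l / r)}.
    by apply: cvgM; [exact: cvg_cst|apply: cvgV => //; rewrite gt_eqF].
  have cwk k : continuous (k y : R -> R) ->
      {for r, continuous (fun r => w r * k y (l / r))}.
    move=> ck; apply: cvgM => //.
    by apply: (@continuous_comp _ _ _ (fun r : R => l / r) (k y)) => //; exact: ck.
  apply: cvgM; first exact: cvg_cst.
  apply: cvgB; last by apply: cvgM; [exact: cvg_cst|exact: cwk].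
  apply: cvgD; first exact: cwk.
  by apply: cvgM; [exact: cvg_cst|exact: cwk].
have s_bounds : 0 < s /\ s < 1 by case/andP: s01.
have h0 : (\int[leb]_(r in Rpos) h r = 0)%R.
  apply: (@integral_total_derivative _ H h dH ch).
  - exact: integrable_EFinZ.
  (* Near r = 0 the power r^(s-1) is at most n + 1 and e^(-z/r) wins: x^2 e^-x <= 2 at x = z (n +
     1). *)
  - apply: (cvg_harmonic_bound (2 / z ^+ 2)) => n; rewrite H_ge0/= /H invrK.
    have n0 : (0 : R) < n.+1%:R by [].
    have p1 : n.+1%:R^-1 `^ (s - 1) <= n.+1%:R :> R.
      rewrite [leRHS](_ : _ = n.+1%:R^-1 `^ (-1)); last first.
        by rewrite powR_inv1 ?invr_ge0// invrK.
      rewrite ger_powR//; last by lra.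
      by rewrite invr_gt0 n0/= invf_le1// ler1n.
    have e1 : expR (- n.+1%:R^-1 - z * n.+1%:R) <= expR (- (z * n.+1%:R)).
      by rewrite ler_expR gerDr oppr_le0 invr_ge0.
    apply: le_trans (ler_pM (powR_ge0 _ _) (expR_ge0 _) p1 e1) _.
    have zn0 : 0 <= z * n.+1%:R by rewrite mulr_ge0// ltW.
    have := sqr_expRN_le2 zn0; set e := expR _ => he.
    have -> : n.+1%:R * e = ((z * n.+1%:R) ^+ 2 * e) * (z ^- 2 * n.+1%:R^-1).
      by field; rewrite !gt_eqF.
    by rewrite -[leRHS]mulrA ler_wpM2r// mulr_ge0// ?invr_ge0 ?sqr_ge0.
  (* At r = n + 1 the power is at most 1, and x e^-x <= 1 suffices. *)
  - apply: (cvg_harmonic_bound 1) => n; rewrite H_ge0/= /H mul1r.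
    have n0 : (0 : R) < n.+1%:R by [].
    have p1 : n.+1%:R `^ (s - 1) <= 1 :> R.
      rewrite -[leRHS](powRr0 n.+1%:R) ler_powR ?ler1n//; lra.
    have e1 : expR (- n.+1%:R - z / n.+1%:R) <= expR (- n.+1%:R).
      by rewrite ler_expR gerDl oppr_le0 divr_ge0// ltW.
    apply: le_trans (ler_pM (powR_ge0 _ _) (expR_ge0 _) p1 e1) _.
    by rewrite mul1r -[leRHS]mul1r ler_pdivlMr// mulrC mulr_expRN_le1.
move: h0; rewrite /h RintegralZl// => /eqP; rewrite mulf_eq0 invr_eq0 gt_eqF//=.
rewrite RintegralB//; last exact: integrable_EFinZ.
rewrite RintegralD//; last exact: integrable_EFinZ.
by rewrite !RintegralZl// subr_eq0 => /eqP.
Qed.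

End subordination.

Lemma powRV {R : realType} (x p : R) : 0 <= x -> x^-1 `^ p = (x `^ p)^-1.
Proof. by move=> x0; rewrite -(powR_inv1 x0) -powRrM mulN1r powRN. Qed.

(** * The integrals in t of the two formulas *)

Section subordination_integrals.
Context {R : realType}.
Local Notation leb := (@lebesgue_measure R).
Local Notation Rpos := (`]0, +oo[%classic : set (measurableTypeR R)).
Local Notation D := (`[(0:R), +oo[%classic : set (measurableTypeR R)).

Let mRpos : measurable Rpos. Proof. exact: measurable_itv. Qed.
Let mD : measurable D. Proof. exact: measurable_itv. Qed.
Let RposE (x : R) : (x \in Rpos) = (0 < x).
Proof. by apply/idP/idP; rewrite inE/= in_itv/= andbT. Qed.

(* A scaling is the composition of two inversions. *)
Lemma integral_scale (c : R) (f : R -> R) : 0 < c ->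
  {in Rpos, continuous f} -> (forall x, 0 < x -> 0 <= f x) ->
  (\int[leb]_(x in Rpos) (f x)%:E = \int[leb]_(x in Rpos) (f (x / c) / c)%:E)%E.
Proof.
move=> c0 cf f0; rewrite (@integral_inversion R 1)//.
rewrite (@integral_inversion R c (fun x => f (1 / x) * (1 / x ^+ 2)))//; last 2 first.
- move=> x; rewrite RposE => x0; apply: cvgM.
    apply: (@continuous_comp _ _ _ (fun x : R => 1 / x) f).
      by apply: cvgM; [exact: cvg_cst|apply: cvgV => //; rewrite gt_eqF].
    by apply: cf; rewrite RposE divr_gt0.
  apply: cvgM; first exact: cvg_cst.
  by apply: cvgV; [rewrite expf_neq0// gt_eqF|exact: exprn_continuous].
- by move=> x x0; rewrite mulr_ge0 ?f0 ?divr_ge0 ?divr_gt0 ?sqr_ge0.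
apply: eq_integral => x; rewrite RposE => x0; congr EFin.
rewrite (_ : 1 / (c / x) = x / c); last by field; rewrite !gt_eqF.
rewrite -mulrA; congr (_ * _); field; by rewrite !gt_eqF.
Qed.

Variables (s y : R).
Hypotheses (s01 : 0 < s < 1) (y0 : 0 < y).

(** The scalar weight of both integrands: p = 1 - s for the formula with (-L)^s f, p = 1 + s for the
    Poisson formula. *)
Definition heat_weight (p t : R) : R := expR (- (y ^+ 2 / (4 * t))) / t `^ p.

Lemma heat_weight_ge0 p t : 0 <= heat_weight p t.
Proof. by rewrite divr_ge0 ?expR_ge0 ?powR_ge0. Qed.

Lemma measurable_heat_weight p : measurable_fun setT (heat_weight p).
Proof.
apply: measurable_funM.
  apply: measurableT_comp; first exact: measurable_expR.
  apply: measurable_funN; apply: measurable_funM => //.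
  by apply: (measurableT_comp measurable_invr); apply: measurable_funM.
by apply: (measurableT_comp measurable_invr); exact: measurable_powR.
Qed.

Lemma continuous_heat_weight p (t : R) : 0 < t ->
  {for t, continuous (heat_weight p)}.
Proof.
move=> t0; apply: cvgM; last first.
  by apply: cvgV; [rewrite gt_eqF// powR_gt0|exact: continuous_powR_gt0].
apply: (@continuous_comp _ _ _ (fun t : R => - (y ^+ 2 / (4 * t))) expR).
  apply: cvgN; apply: cvgM; first exact: cvg_cst.
  apply: cvgV; first by rewrite gt_eqF// mulr_gt0.
  by apply: cvgM => //; exact: cvg_cst.
exact: continuous_expR.
Qed.

Let continuous_heat (l t : R) : {for t, continuous (fun t : R => expR (- (t * l)))}.
Proof.
apply: (@continuous_comp _ _ _ (fun t : R => - (t * l)) expR).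
  by apply: cvgN; apply: cvgM => //; exact: cvg_cst.
exact: continuous_expR.
Qed.

(** The inversion t = K / r with K = y^2 / 4 exchanges the two exponentials, and t^(-1-s) dt becomes
    K^-s r^(s-1) dr. The constant in front is K^-s. *)
Lemma poisson_weight_integral (l : R) : 0 <= l ->
  (\int[leb]_(t in Rpos) (heat_weight (1 + s) t * expR (- (t * l)))%:E =
   (2 `^ (2 * s) / y `^ (2 * s) * gamma_avg s kernel0 y l)%:E)%E.
Proof.
move=> l0; have K0 : 0 < y ^+ 2 / 4 by rewrite divr_gt0// exprn_gt0.
rewrite (integral_inversion K0); last 2 first.
- move=> t; rewrite RposE => t0; apply: cvgM; first exact: continuous_heat_weight.
  exact: continuous_heat.
- by move=> t _; rewrite mulr_ge0 ?heat_weight_ge0 ?expR_ge0.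
have i0 := gamma_avg_integrable s01 l (measurable_kernel0 y)
  (fun q => ltac:(rewrite ger0_norm; [exact: kernel0_le1|exact: ltW (kernel0_gt0 _ _)])).
rewrite /gamma_avg -RintegralZl// /Rintegral fineK; last first.
  by apply: integrable_fin_num => //; exact: integrable_EFinZ.
apply: eq_integral => r; rewrite RposE => r0; congr EFin.
rewrite /heat_weight /gamma_weight /kernel0 ger0_norm; last by rewrite divr_ge0// ltW.
set K := y ^+ 2 / 4 in K0 *.
have -> : y ^+ 2 / (4 * (K / r)) = r by rewrite /K; field; rewrite !gt_eqF.
have -> : K / r * l = y ^+ 2 * (l / r) / 4 by rewrite /K; field; rewrite gt_eqF.
have KE : K `^ s = y `^ (2 * s) / 2 `^ (2 * s).
  rewrite /K powRM ?exprn_ge0 ?(ltW y0)// powRV// !powRrM !powR_mulrn ?(ltW y0)//.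
  by congr (_ / _ `^ _); ring.
have -> : (K / r) `^ (1 + s) = (K / r) * (K `^ s / r `^ s).
  have Kr0 : 0 < K / r by rewrite divr_gt0.
  rewrite powRD; last by rewrite (gt_eqF Kr0) implybT.
  by rewrite (powRr1 (ltW Kr0)) powRM ?invr_ge0 ?(ltW K0) ?(ltW r0)// powRV ?(ltW r0).
rewrite KE [r `^ (s - 1)]powRB ?(gt_eqF r0) ?implybT// powRr1 ?(ltW r0)//.
move: (expR _) (expR _) => e1 e2.
have p1 : 0 < y `^ (2 * s) by rewrite powR_gt0.
have p2 : 0 < (2 : R) `^ (2 * s) by rewrite powR_gt0.
have p3 : 0 < r `^ s by rewrite powR_gt0.
move: (y `^ _) (2 `^ _) (r `^ _) p1 p2 p3 => A B C A0 B0 C0.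
by field; rewrite !gt_eqF.
Qed.

(** For l > 0 the scaling t = r / l leaves no constant: the powers of l in t^(s-1) dt cancel l^s. At
    l = 0 the factor l^s kills the integrand, which the boolean factor records. *)
Lemma extension_weight_integral (l : R) : 0 <= l ->
  (\int[leb]_(t in Rpos) (heat_weight (1 - s) t * (expR (- (t * l)) * l `^ s))%:E =
   ((l != 0)%:R * gamma_avg s kernel0 y l)%:E)%E.
Proof.
rewrite le_eqVlt => /predU1P[<-|l0].
  rewrite eqxx mul0r; apply: integral0_eq => t _.
  by rewrite powR0 ?mulr0// gt_eqF//; case/andP: s01.
rewrite gt_eqF// mul1r (integral_scale l0); last 2 first.
- move=> t; rewrite RposE => t0; apply: cvgM; first exact: continuous_heat_weight.
  by apply: cvgM; [exact: continuous_heat|exact: cvg_cst].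
- by move=> t _; apply: mulr_ge0 (heat_weight_ge0 _ _) _; rewrite mulr_ge0 ?expR_ge0 ?powR_ge0.
have i0 := gamma_avg_integrable s01 l (measurable_kernel0 y)
  (fun q => ltac:(rewrite ger0_norm; [exact: kernel0_le1|exact: ltW (kernel0_gt0 _ _)])).
rewrite /gamma_avg /Rintegral fineK; last exact: integrable_fin_num.
apply: eq_integral => r; rewrite RposE => r0; congr EFin.
rewrite /heat_weight /gamma_weight /kernel0 ger0_norm; last by rewrite divr_ge0// ltW.
have -> : y ^+ 2 / (4 * (r / l)) = y ^+ 2 * (l / r) / 4 by field; rewrite !gt_eqF.
have -> : r / l * l = r by field; rewrite gt_eqF.
rewrite powRM ?invr_ge0 ?(ltW r0) ?(ltW l0)// powRV ?(ltW l0)//.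
rewrite !powRB ?(gt_eqF r0) ?(gt_eqF l0) ?implybT// !powRr1 ?(ltW r0) ?(ltW l0)//.
move: (expR _) (expR _) => e1 e2.
have p1 : 0 < r `^ s by rewrite powR_gt0.
have p2 : 0 < l `^ s by rewrite powR_gt0.
move: (r `^ _) (l `^ _) p1 p2 => A B A0 B0.
by field; rewrite !gt_eqF.
Qed.

Section tonelli.
Variable m : {finite_measure set (measurableTypeR R) -> \bar R}.
Variables (kap : R -> R) (b Phi : measurableTypeR R -> R) (M : R).
Hypotheses (mkap : measurable_fun setT kap) (kap0 : forall t, 0 <= kap t).
Hypotheses (mb : measurable_fun setT b) (b0 : forall l, D l -> 0 <= b l).
Hypothesis intb : (\int[m]_(l in D) (b l)%:E < +oo)%E.
Hypotheses (mPhi : measurable_fun setT Phi) (PhiM : forall l, D l -> `|Phi l| <= M).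
Hypothesis PhiE : forall l, D l ->
  (\int[leb]_(t in Rpos) (kap t * (expR (- (t * l)) * b l))%:E = (Phi l)%:E)%E.

(** Everything is nonnegative, so the exchange needs no integrability on the product; that of the
    t-integrand follows from the bound on [Phi]. Integrability of b makes the inner integral finite
    at each t > 0, so its real value is the extended one. *)
Lemma laplace_tonelli :
  leb.-integrable Rpos (EFin \o (fun t : R => kap t *
    (\int[m]_(l in D) (expR (- (t * l)) * b l))%R)) /\
  (\int[leb]_(t in Rpos) (kap t * (\int[m]_(l in D) (expR (- (t * l)) * b l)))
   = \int[m]_(l in D) Phi l)%R.
Proof.
pose b' := b \_ D; have b'0 l : 0 <= b' l.
  by rewrite /b' patchE; case: ifPn => // /[!inE]; exact: b0.
have mb' : measurable_fun setT b'.
  by apply/(measurable_restrictT _ mD)/measurable_funTS.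
pose f (z : measurableTypeR R * measurableTypeR R) : \bar R :=
  ((\1_Rpos z.2 : R) * (kap z.2 * (expR (- (z.2 * z.1)) * b' z.1)))%:E.
have f0 z : (0 <= f z)%E by rewrite lee_fin !mulr_ge0 ?expR_ge0.
have mf : measurable_fun setT f.
  apply/measurable_EFinP; apply: measurable_funM.
    by apply: (measurableT_comp (measurable_indic mRpos)).
  apply: measurable_funM; first by apply: (measurableT_comp mkap).
  apply: measurable_funM; last by apply: (measurableT_comp mb').
  apply: measurableT_comp; first exact: measurable_expR.
  by apply: measurable_funN; apply: measurable_funM.
have b'E (h : R -> R) : (\int[m]_l (h l * b' l)%:E = \int[m]_(l in D) (h l * b l)%:E)%E.
  rewrite [RHS]integral_mkcond; apply: eq_integral => l _.
  by rewrite /b' !patchE; case: ifPn => //; rewrite mulr0.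
have iPhi : m.-integrable D (EFin \o Phi) by exact: bounded_integrable PhiM.
have lhsE : (\int[m]_l \int[leb]_t f (l, t) = \int[m]_(l in D) (Phi l)%:E)%E.
  rewrite [RHS]integral_mkcond; apply: eq_integral => l _.
  rewrite patchE; case: ifPn => [/[!inE] Dl|Dl].
    rewrite -PhiE// [RHS]integral_mkcond epatch_indic; apply: eq_integral => t _.
    by rewrite /f /b' /= patchE mem_set// -EFinM mulrC.
  by apply: integral0_eq => t _; rewrite /f /b' /= patchE (negbTE Dl) !mulr0.
pose J t := kap t * (\int[m]_(l in D) (expR (- (t * l)) * b l))%R.
have JE t : Rpos t -> fubini_G m f t = (J t)%:E.
  move=> Rt; rewrite /fubini_G /f /= indicE mem_set//=.
  have t0 : 0 < t by move: Rt; rewrite /= in_itv/= andbT.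
  have me : measurable_fun setT (fun l : R => expR (- (t * l))).
    apply: measurableT_comp; first exact: measurable_expR.
    by apply: measurable_funN; apply: measurable_funM.
  under eq_integral do rewrite mul1r EFinM.
  rewrite ge0_integralZl//; last 3 first.
  - by apply/measurable_EFinP; apply: measurable_funM.
  - by move=> l _; rewrite lee_fin mulr_ge0 ?expR_ge0.
  - by rewrite lee_fin.
  rewrite (b'E (fun l => expR (- (t * l)))) /J EFinM /Rintegral fineK//.
  rewrite ge0_fin_numE; last first.
    by apply: integral_ge0 => l Dl; rewrite lee_fin mulr_ge0 ?expR_ge0 ?b0.
  apply: le_lt_trans intb; apply: ge0_le_integral => //.
  - by move=> l Dl; rewrite lee_fin mulr_ge0 ?expR_ge0 ?b0.
  - by apply/measurable_EFinP; apply: measurable_funTS; apply: measurable_funM.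
  - by apply/measurable_EFinP; apply: measurable_funTS.
  - move=> l Dl; rewrite lee_fin ler_piMl ?b0// expR_le1 oppr_le0 mulr_ge0 ?(ltW t0)//.
    by move: Dl; rewrite /= in_itv/= andbT.
have GE : (\int[leb]_t fubini_G m f t = \int[leb]_(t in Rpos) (J t)%:E)%E.
  rewrite [RHS]integral_mkcond; apply: eq_integral => t _.
  rewrite patchE; case: ifPn => [/[!inE] Rt|Rt]; first exact: JE.
  by apply: integral0_eq => l _; rewrite /f /= indicE (negbTE Rt) mul0r.
have main : (\int[leb]_(t in Rpos) (J t)%:E = \int[m]_(l in D) (Phi l)%:E)%E.
  by rewrite -GE -lhsE (fubini_tonelli f mf f0).
split; last by rewrite /Rintegral main.
apply/integrableP; split.
  apply: (eq_measurable_fun (fubini_G m f)).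
    by move=> t /[!inE] Rt; rewrite JE.
  by apply: measurable_funTS; exact: measurable_fun_fubini_tonelli_G.
rewrite (_ : (\int[leb]_(t in Rpos) _)%E = (\int[leb]_(t in Rpos) (J t)%:E)%E).
  by rewrite main ltey_eq (integrable_fin_num mD iPhi).
apply: eq_integral => t _; rewrite /= ger0_norm// mulr_ge0// Rintegral_ge0//.
by move=> l Dl; rewrite mulr_ge0 ?expR_ge0 ?b0.
Qed.

End tonelli.

End subordination_integrals.

(** * The extension problem *)

Section extension_problem.
Context d {T : measurableType d} {R : realType}.
Context {mu : {measure set T -> \bar R}}.
Variables (F : set (L2 mu)) (form : L2 mu -> L2 mu -> R).
Variables (E : spectralMeasure mu) (L : operator mu).
Hypothesis hL : generator F form E L.
Implicit Types (u v g f : L2 mu) (phi psi : measurableTypeR R -> R).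
Local Notation leb := (@lebesgue_measure R).
Local Notation Rpos := (`]0, +oo[%classic : set (measurableTypeR R)).
Local Notation D := (`[(0:R), +oo[%classic : set (measurableTypeR R)).

Let mRpos : measurable Rpos. Proof. exact: measurable_itv. Qed.
Let mD : measurable D. Proof. exact: measurable_itv. Qed.
Let D_ge0 (l : R) : D l -> 0 <= l.
Proof. by rewrite /= in_itv/= andbT. Qed.

(** A real-valued pairing, linear on bounded multipliers of any sign, as the averages of [kernel1]
    and [kernel2] require. *)
Definition spec_Rintegral phi u g : R :=
  \int[spec_pos E u g]_(l in D) phi l - \int[spec_neg E u g]_(l in D) phi l.

Lemma spec_rep_Rintegral phi u v : (forall l, D l -> 0 <= phi l) ->
  spec_rep E phi u v -> forall g, l2dot v g = spec_Rintegral phi u g.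
Proof.
move=> phi0 rv g; have [h1 h2 h3] := rv g.
have fin (m : {measure set (measurableTypeR R) -> \bar R}) :
    (\int[m]_(l in D) (phi l)%:E < +oo)%E ->
    ((\int[m]_(l in D) phi l)%R)%:E = (\int[m]_(l in D) (phi l)%:E)%E.
  move=> my; rewrite /Rintegral fineK// ge0_fin_numE//.
  by apply: integral_ge0 => l Dl; rewrite lee_fin phi0.
by apply: EFin_inj; rewrite h3 spec_integralE EFinB !fin.
Qed.

Lemma spec_RintegralD (M1 M2 : R) phi psi u g :
  measurable_fun setT phi -> measurable_fun setT psi ->
  (forall l, D l -> `|phi l| <= M1) -> (forall l, D l -> `|psi l| <= M2) ->
  spec_Rintegral (phi \+ psi) u g = spec_Rintegral phi u g + spec_Rintegral psi u g.
Proof.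
move=> mphi mpsi phiM psiM; rewrite /spec_Rintegral !RintegralD//;
  try by [exact: bounded_integrable phiM|exact: bounded_integrable psiM].
ring.
Qed.

Lemma spec_RintegralZ (c M : R) phi u g : measurable_fun setT phi ->
  (forall l, D l -> `|phi l| <= M) ->
  spec_Rintegral (fun l => c * phi l) u g = c * spec_Rintegral phi u g.
Proof.
move=> mphi phiM; rewrite /spec_Rintegral !RintegralZl//;
  try exact: bounded_integrable phiM.
ring.
Qed.

Lemma eq_spec_Rintegral phi psi u g : (forall l, D l -> phi l = psi l) ->
  spec_Rintegral phi u g = spec_Rintegral psi u g.
Proof.
move=> e; rewrite /spec_Rintegral.
by congr (_ - _); apply: eq_Rintegral => l /[!inE] /e.
Qed.

Lemma spec_rep_ge0 (M : R) phi u v : measurable_fun setT phi ->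
  (forall l, D l -> 0 <= phi l <= M) ->
  (forall g, l2dot v g = spec_Rintegral phi u g) -> spec_rep E phi u v.
Proof.
move=> mphi phiM vE; have [v' rv] := spec_rep_bounded E u mphi phiM.
have phi0 l : D l -> 0 <= phi l by move=> /phiM /andP[].
move=> g; have [h1 h2 <-] := rv g; split => //.
by rewrite vE -(spec_rep_Rintegral phi0 rv).
Qed.

(** The signed multiplier is the difference of the nonnegative bounded ones phi + M and M, each of
    which has a representing vector. *)
Lemma spec_vector_ex (M : R) phi u : measurable_fun setT phi ->
  (forall l, D l -> `|phi l| <= M) ->
  exists v, forall g, l2dot v g = spec_Rintegral phi u g.
Proof.
move=> mphi phiM.
have M0 : 0 <= M by apply: le_trans (normr_ge0 _) (phiM 0 _); rewrite /= in_itv/= lexx.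
have b1 l : D l -> 0 <= phi l + M <= M + M.
  by move=> /phiM; rewrite ler_norml; lra.
have mp : measurable_fun setT (phi \+ cst M) by exact: measurable_funD.
have b2 (l : measurableTypeR R) : D l -> 0 <= (cst M l : R) <= M by rewrite /= M0 lexx.
have [v1 r1] := spec_rep_bounded E u mp b1.
have [v2 r2] := spec_rep_bounded E u (@measurable_cst _ _ (measurableTypeR R) R setT M) b2.
exists (v1 - v2) => g; rewrite l2dotBl.
rewrite (spec_rep_Rintegral _ r1); last by move=> l /b1 /andP[].
rewrite (spec_rep_Rintegral _ r2); last by move=> l /b2 /andP[].
rewrite (@spec_RintegralD M M)// ?addrK// => l _.
by rewrite ger0_norm.
Qed.

Lemma spec_heat_rep t u : 0 < t ->
  spec_rep E (fun l => expR (- (t * l))) u (heat E t u).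
Proof.
move=> t0; have me : measurable_fun setT (fun l : measurableTypeR R => expR (- (t * l))).
  apply: measurableT_comp; first exact: measurable_expR.
  by apply: measurable_funN; apply: measurable_funM.
have [l Dl|v rv] := @spec_rep_bounded _ _ _ _ E 1 _ u me.
  by rewrite expR_ge0/= expR_le1 oppr_le0 mulr_ge0 ?(ltW t0)// D_ge0.
exact: spec_rep_calc rv.
Qed.

(** The common core of both formulas: kap is the weight in t, b the multiplier on which the heat
    semigroup acts, phi the resulting t-integral. Tonelli is applied to the two Jordan parts
    separately. The vector chosen by [weak_integral] may differ from v, but their pairings agree. *)
Lemma weak_integral_ex (G : R -> L2 mu) phi f (M : R) (kap : R -> R)
    (b : measurableTypeR R -> R) :
  measurable_fun setT kap -> (forall t, 0 <= kap t) ->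
  measurable_fun setT b -> (forall l, D l -> 0 <= b l) ->
  (forall g, (\int[spec_pos E f g]_(l in D) (b l)%:E < +oo)%E) ->
  (forall g, (\int[spec_neg E f g]_(l in D) (b l)%:E < +oo)%E) ->
  measurable_fun setT phi -> (forall l, D l -> `|phi l| <= M) ->
  (forall l, D l -> (\int[leb]_(t in Rpos) (kap t * (expR (- (t * l)) * b l))%:E
    = (phi l)%:E)%E) ->
  (forall t, 0 < t -> forall g, l2dot (G t) g =
     kap t * spec_Rintegral (fun l => expR (- (t * l)) * b l) f g) ->
  weakly_integrable G /\
  forall g, l2dot (weak_integral G) g = spec_Rintegral phi f g.
Proof.
move=> mkap kap0 mb b0 bp bn mphi phiM phiE GE.
have [v vE] := spec_vector_ex f mphi phiM.
have wv : weak_integral_of G v.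
  move=> g.
  have [i1 e1] := laplace_tonelli mkap kap0 mb b0 (bp g) mphi phiM phiE.
  have [i2 e2] := laplace_tonelli mkap kap0 mb b0 (bn g) mphi phiM phiE.
  pose h t := kap t * (\int[spec_pos E f g]_(l in D) (expR (- (t * l)) * b l)) -
     kap t * (\int[spec_neg E f g]_(l in D) (expR (- (t * l)) * b l)).
  have hE : {in Rpos, h =1 (fun t => l2dot (G t) g)}.
    by move=> t; rewrite inE/= in_itv/= andbT => t0; rewrite GE// mulrBr.
  split.
    apply: eq_integrable (integrable_EFinB mRpos i1 i2) => //.
    by move=> t Rt; rewrite /= -hE.
  rewrite vE -(eq_Rintegral _ hE) RintegralB//.
  by rewrite e1 e2.
split; first by exists v.
have wi : weak_integral_of G (weak_integral G).
  by apply: (@xgetPex _ 0 [set v | weak_integral_of G v]); exists v.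
by move=> g; have [_ ->] := wi g; have [_ <-] := wv g.
Qed.

Variables (s a : R) (f : L2 mu).
Hypotheses (s01 : 0 < s < 1) (aE : a = 1 - 2 * s).

Let gam0 : 0 < gammaR s. Proof. exact: gammaR_gt0. Qed.

Let k0M (y q : R) : `|kernel0 y q| <= 1.
Proof. by rewrite ger0_norm ?kernel0_le1// ltW// kernel0_gt0. Qed.

(** The notion of solution is tested on pairings, so any family with the pairings of psi(y, -L) f
    qualifies. This lets one argument serve both formulas. *)
Lemma l2_weak_solution_spec (U : R -> L2 mu) :
  (forall y, 0 < y -> forall g, l2dot (U y) g =
    (gammaR s)^-1 * spec_Rintegral (gamma_avg s kernel0 y) f g) ->
  l2_weak_solution L a U f.
Proof.
move=> UE.
have mk0 y : measurable_fun setT (gamma_avg s kernel0 y).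
  exact: measurable_gamma_avg (measurable_kernel0 y) (k0M y).
have mk1 (y : R) : 0 < y -> measurable_fun setT (gamma_avg s kernel1 y).
  move=> y0; exact: measurable_gamma_avg (measurable_kernel1 y) (fun q => kernel1_le q y0).
have mk2 (y : R) : 0 < y -> measurable_fun setT (gamma_avg s kernel2 y).
  move=> y0; exact: measurable_gamma_avg (measurable_kernel2 y) (fun q => kernel2_le q y0).
have b0 y l : `|gamma_avg s kernel0 y l| <= 1 * gammaR s.
  exact: gamma_avg_le (measurable_kernel0 y) (k0M y).
have b1 (y : R) l : 0 < y -> `|gamma_avg s kernel1 y l| <= 2 / y * gammaR s.
  move=> y0; exact: gamma_avg_le (measurable_kernel1 y) (fun q => kernel1_le q y0).
have b2 (y : R) l : 0 < y -> `|gamma_avg s kernel2 y l| <= 10 / y ^+ 2 * gammaR s.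
  move=> y0; exact: gamma_avg_le (measurable_kernel2 y) (fun q => kernel2_le q y0).
have ex (k : R -> R -> R) : (forall y : R, 0 < y -> exists M : R, measurable_fun setT (gamma_avg s k y) /\
    forall l, `|gamma_avg s k y l| <= M) ->
  exists V : R -> L2 mu, forall y, 0 < y -> forall g, l2dot (V y) g =
    (gammaR s)^-1 * spec_Rintegral (gamma_avg s k y) f g.
  (* [choice] asks for a vector at every real y; at y <= 0 it receives 0. *)
  move=> kM; suff H y : exists v, 0 < y -> forall g, l2dot v g =
      (gammaR s)^-1 * spec_Rintegral (gamma_avg s k y) f g.
    by have [V VE] := choice H; exists V; exact: VE.
  have [y0|_] := ltP 0 y; last by exists 0.
  have [M [mk bk]] := kM _ y0.
  have [v vE] := spec_vector_ex f mk (fun l _ => bk l).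
  by exists ((gammaR s)^-1 *: v) => _ g; rewrite l2dotZl vE.
have [|U1 U1E] := ex kernel1.
  by move=> y y0; exists (2 / y * gammaR s); split; [exact: mk1|move=> l; exact: b1].
have [|U2 U2E] := ex kernel2.
  by move=> y y0; exists (10 / y ^+ 2 * gammaR s); split; [exact: mk2|move=> l; exact: b2].
have wd (k k' : R -> R -> R) (V V' : R -> L2 mu) :
    (forall z, measurable_fun setT (k z)) -> (forall z, measurable_fun setT (k' z)) ->
    (forall z q : R, is_derive z 1 (k ^~ q) (k' z q)) ->
    (forall y : R, 0 < y -> exists M : R, forall z q, y / 4 < z -> `|k z q| <= M /\ `|k' z q| <= M) ->
    (forall y, 0 < y -> forall g, l2dot (V y) g =
      (gammaR s)^-1 * spec_Rintegral (gamma_avg s k y) f g) ->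
    (forall y, 0 < y -> forall g, l2dot (V' y) g =
      (gammaR s)^-1 * spec_Rintegral (gamma_avg s k' y) f g) ->
    weak_derivative V V'.
  move=> mk mk' dk kM VE V'E y y0 g; have [M kMy] := kM _ y0.
  have kM1 z q : y / 4 < z -> `|k z q| <= M by move=> /(kMy z q)[].
  have kM2 z q : y / 4 < z -> `|k' z q| <= M by move=> /(kMy z q)[].
  have d1 := is_derive_integral_gamma_avg s01 (spec_pos E f g) mk mk' dk y0 kM1 kM2.
  have d2 := is_derive_integral_gamma_avg s01 (spec_neg E f g) mk mk' dk y0 kM1 kM2.
  have d3 := is_deriveZ (gammaR s)^-1 (is_deriveB d1 d2).
  rewrite V'E//; apply: near_eq_is_derive d3.
  by near=> z; apply/esym/VE; near: z; exact: lt_nbhsr.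
have a0 y l : 0 <= gamma_avg s kernel0 y l.
  by apply: Rintegral_ge0 => r _; rewrite mulr_ge0 ?gamma_weight_ge0// ltW// kernel0_gt0.
have key (y : R) : 0 < y -> op_dom L (U y) /\ forall g, l2dot (L (U y)) g =
    - ((gammaR s)^-1 * (spec_Rintegral (gamma_avg s kernel2 y) f g +
       a / y * spec_Rintegral (gamma_avg s kernel1 y) f g)).
  move=> y0; pose phi l := (gammaR s)^-1 * gamma_avg s kernel0 y l.
  have mphi : measurable_fun setT phi by exact: measurable_funM.
  have phi1 l : D l -> 0 <= phi l <= 1.
    move=> _; rewrite /phi mulr_ge0 ?invr_ge0 ?(ltW gam0)//= mulrC ler_pdivrMr//.
    by have := b0 y l; rewrite ger0_norm.
  have phi0 l : D l -> 0 <= phi l by move=> /phi1 /andP[].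
  have rU : spec_rep E phi f (U y).
    apply: (spec_rep_ge0 mphi phi1) => g.
    rewrite UE// -(@spec_RintegralZ _ (1 * gammaR s))//.
  have mid : measurable_fun setT ((fun l : measurableTypeR R => l : R) \* phi).
    exact: measurable_funM.
  pose M := (gammaR s)^-1 * (10 / y ^+ 2 * gammaR s + `|a / y| * (2 / y * gammaR s)).
  have odeE l : D l -> l * phi l = (gammaR s)^-1 *
      (gamma_avg s kernel2 y l + a / y * gamma_avg s kernel1 y l).
    by move=> Dl; rewrite gamma_avg_ode ?D_ge0// /phi mulrCA.
  (* l is unbounded on [D], but the differential equation replaces l phi(l) by averages of [kernel2]
     and [kernel1], which are bounded; this is what puts U(y) in the domain of L. *)
  have bphi l : D l -> 0 <= ((fun l : measurableTypeR R => l : R) \* phi) l <= M.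
    move=> Dl; rewrite /= mulr_ge0 ?phi0 ?D_ge0//= odeE// /M.
    rewrite ler_wpM2l ?invr_ge0 ?(ltW gam0)//; apply: lerD.
      exact: le_trans (ler_norm _) (b2 _ _ y0).
    apply: le_trans (ler_norm _) _; rewrite normrM ler_wpM2l//; exact: b1.
  have [W rW] := spec_rep_bounded E f mid bphi.
  have [dU LU] := generator_app hL mphi phi0 rU rW; split => // g.
  rewrite (eq_l2dotl _ LU) l2dotNl (spec_rep_Rintegral _ rW); last first.
    by move=> l /bphi /andP[].
  congr (- _); rewrite (eq_spec_Rintegral _ _ odeE).
  have m1' : measurable_fun setT (fun l => a / y * gamma_avg s kernel1 y l).
    by apply: measurable_funM => //; exact: mk1.
  have b1' l : D l -> `|a / y * gamma_avg s kernel1 y l| <= `|a / y| * (2 / y * gammaR s).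
    by move=> _; rewrite normrM ler_wpM2l//; exact: b1.
  have b2' l : D l -> `|gamma_avg s kernel2 y l| <= 10 / y ^+ 2 * gammaR s.
    by move=> _; exact: b2.
  rewrite (@spec_RintegralZ _ (10 / y ^+ 2 * gammaR s + `|a / y| * (2 / y * gammaR s))); last 2 first.
  - by apply: measurable_funD m1'; exact: mk2.
  - by move=> l Dl; apply: le_trans (ler_normD _ _) _; rewrite lerD ?b2' ?b1'.
  congr (_ * _); rewrite (spec_RintegralD _ _ (mk2 _ y0) m1' b2' b1').
  by rewrite (@spec_RintegralZ _ (2 / y * gammaR s) _ _ _ (mk1 _ y0) (fun l _ => b1 y l y0)).
split; first by move=> y /key[].
split.
  exists U1, U2; split.
  - apply: (wd kernel0 kernel1) UE U1E.
    + exact: measurable_kernel0.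
    + exact: measurable_kernel1.
    + exact: is_derive_kernel0.
    (* 1 bounds [kernel0], and z > y / 4 turns 2 / z into 8 / y. *)
    + move=> y y0; exists (1 + 8 / y) => z q yz.
      have z0 : 0 < z by rewrite (lt_trans _ yz)// divr_gt0.
      have y8 : 0 <= 8 / y by rewrite divr_ge0// ltW.
      split; first by apply: le_trans (k0M z q) _; rewrite lerDl.
      apply: le_trans (kernel1_le q z0) _; rewrite (@le_trans _ _ (8 / y))// ?lerDr//.
      by rewrite ler_pdivrMr// mulrAC ler_pdivlMr//; lra.
  - apply: (wd kernel1 kernel2) U1E U2E.
    + exact: measurable_kernel1.
    + exact: measurable_kernel2.
    + exact: is_derive_kernel1.
    (* Likewise z > y / 4 turns 10 / z^2 into 160 / y^2. *)
    + move=> y y0; exists (8 / y + 160 / y ^+ 2) => z q yz.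
      have z0 : 0 < z by rewrite (lt_trans _ yz)// divr_gt0.
      have y8 : 0 <= 8 / y by rewrite divr_ge0// ltW.
      have y160 : 0 <= 160 / y ^+ 2 by rewrite divr_ge0// sqr_ge0.
      split.
        apply: le_trans (kernel1_le q z0) _; rewrite (@le_trans _ _ (8 / y))// ?lerDl//.
        by rewrite ler_pdivrMr// mulrAC ler_pdivlMr//; lra.
      apply: le_trans (kernel2_le q z0) _; rewrite (@le_trans _ _ (160 / y ^+ 2))// ?lerDr//.
      rewrite ler_pdivrMr ?exprn_gt0// mulrAC ler_pdivlMr ?exprn_gt0// !expr2; nra.
  - move=> y y0 g; have [_ LE] := key y y0.
    rewrite l2dotDl LE l2dotDl l2dotZl (U1E _ y0) (U2E _ y0).
    by move: (spec_Rintegral _ _ _) (spec_Rintegral _ _ _) => r1 r2; ring.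
move=> g.
have c1 := @cvg_integral_gamma_avg _ _ s01 (spec_pos E f g).
have c2 := @cvg_integral_gamma_avg _ _ s01 (spec_neg E f g).
(* The whole mass of the spectral measure is on [D], since E([0, +oo[) f = f; so <f, g> is the
   charge of [D]. *)
have -> : l2dot f g = (gammaR s)^-1 * (gammaR s * fine (spec_pos E f g D) -
    gammaR s * fine (spec_neg E f g D)).
  have [gp [gn [posE negE gE]]] := spec_jordan E f g.
  have [Df _] := generator_spectral hL.
  rewrite -(eq_l2dotl g (Df f)) gE posE// negE//= -mulrBr mulKf// gt_eqF//.
apply: (@cvg_trans _ ((gammaR s)^-1 * (\int[spec_pos E f g]_(l in D) gamma_avg s kernel0 y l
  - \int[spec_neg E f g]_(l in D) gamma_avg s kernel0 y l) @[y --> 0^'+])).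
  apply: near_eq_cvg; near=> y; rewrite UE//.
by apply: cvgM; [exact: cvg_cst|exact: cvgB].
Unshelve. all: by end_near. Qed.


End extension_problem.

(** * The Poisson formula and the formula with (-L)^s f *)

Section extension_formulas.
Context d {T : measurableType d} {R : realType}.
Context {mu : {measure set T -> \bar R}}.
Variables (F : set (L2 mu)) (form : L2 mu -> L2 mu -> R).
Variables (E : spectralMeasure mu) (L : operator mu).
Hypothesis hL : generator F form E L.
Implicit Types (u v g : L2 mu) (phi psi : measurableTypeR R -> R).
Local Notation D := (`[(0:R), +oo[%classic : set (measurableTypeR R)).

Let mD : measurable D. Proof. exact: measurable_itv. Qed.
Let D_ge0 (l : R) : D l -> 0 <= l.
Proof. by rewrite /= in_itv/= andbT. Qed.

Variables (s : R) (f : L2 mu).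
Hypothesis s01 : 0 < s < 1.

Let gam0 : 0 < gammaR s. Proof. exact: gammaR_gt0. Qed.

Let k0M (y q : R) : `|kernel0 y q| <= 1.
Proof. by rewrite ger0_norm ?kernel0_le1// ltW// kernel0_gt0. Qed.

Let mk0 y : measurable_fun setT (gamma_avg s kernel0 y).
Proof. exact: measurable_gamma_avg (measurable_kernel0 y) (k0M y). Qed.

Let b0 y l : `|gamma_avg s kernel0 y l| <= 1 * gammaR s.
Proof. exact: gamma_avg_le (measurable_kernel0 y) (k0M y). Qed.

Lemma poisson_spec (y : R) : 0 < y ->
  weakly_integrable (poisson_integrand E s f y) /\
  forall g, l2dot (poisson E s f y) g =
    (gammaR s)^-1 * spec_Rintegral E (gamma_avg s kernel0 y) f g.
Proof.
(* c is the constant left by the inversion; the prefactor of [poisson] is the inverse of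
   [c * gammaR s]. *)
move=> y0; pose c : R := 2 `^ (2 * s) / y `^ (2 * s).
have c0 : 0 < c by rewrite divr_gt0 ?powR_gt0.
have fin1 (m : {finite_measure set (measurableTypeR R) -> \bar R}) :
    (\int[m]_(l in D) (cst 1 l : R)%:E < +oo)%E.
  have -> : (\int[m]_(l in D) (cst 1 l : R)%:E = 1 * m D)%E by rewrite -integral_cst.
  by rewrite mul1e ltey_eq fin_num_measure.
have [||||||||||wi wE] := @weak_integral_ex _ _ _ _ E (poisson_integrand E s f y)
  (fun l => c * gamma_avg s kernel0 y l) f (c * (1 * gammaR s))
  (heat_weight y (1 + s)) (cst 1).
- exact: measurable_heat_weight.
- exact: heat_weight_ge0.
- exact: measurable_cst.
- by [].
- by move=> g; exact: fin1.
- by move=> g; exact: fin1.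
- exact: measurable_funM.
- by move=> l _; rewrite normrM (gtr0_norm c0) ler_wpM2l// ltW.
- by move=> l Dl; under eq_integral do rewrite mulr1; rewrite poisson_weight_integral// D_ge0.
- move=> t t0 g; rewrite l2dotZl; congr (_ * _).
  rewrite (spec_rep_Rintegral _ (spec_heat_rep E f t0)); last first.
    by move=> l _; rewrite expR_ge0.
  by apply: eq_spec_Rintegral => l _; rewrite mulr1.
split => // g; rewrite l2dotZl wE (@spec_RintegralZ _ _ _ _ _ _ (1 * gammaR s))//.
rewrite mulrA; congr (_ * _); rewrite /c; field.
by rewrite !gt_eqF ?powR_gt0.
Qed.

Hypothesis fs : op_dom (pow_op E s) f.

Lemma extension_spec (y : R) : 0 < y ->
  weakly_integrable (extension_integrand E s f y) /\
  forall g, l2dot (extension E s f y) g = (gammaR s)^-1 *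
    spec_Rintegral E (fun l => (l != 0)%:R * gamma_avg s kernel0 y l) f g.
Proof.
move=> y0; pose b (l : measurableTypeR R) := l `^ s.
have mb : measurable_fun setT b by exact: measurable_powR.
have b_ge0 l : D l -> 0 <= b l by move=> _; exact: powR_ge0.
have rf : spec_rep E b f (pow_op E s f).
  move: fs; rewrite /= spec_integral_diag => fs'.
  by have [v rv] := spec_rep_ex mb b_ge0 fs'; exact: spec_rep_calc rv.
have m0 : measurable_fun setT (fun l : measurableTypeR R => (l != 0)%:R : R).
  rewrite (_ : (fun l => _) = \1_(~` [set 0])); last first.
    by apply/funext => l; rewrite indicE in_setC in_set1.
  by apply: measurable_indic; apply: measurableC; exact: measurable_set1.
have [||||||||||wi wE] := @weak_integral_ex _ _ _ _ E (extension_integrand E s f y)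
  (fun l => (l != 0)%:R * gamma_avg s kernel0 y l) f (1 * gammaR s)
  (heat_weight y (1 - s)) b.
- exact: measurable_heat_weight.
- exact: heat_weight_ge0.
- exact: mb.
- exact: b_ge0.
- by move=> g; have [] := rf g.
- by move=> g; have [] := rf g.
- exact: measurable_funM.
- move=> l _; rewrite normrM; apply: le_trans (b0 y l).
  by rewrite ler_piMl// ger0_norm// lern1 leq_b1.
- by move=> l Dl; rewrite extension_weight_integral// D_ge0.
- move=> t t0 g; rewrite l2dotZl; congr (_ * _).
  pose e (l : measurableTypeR R) := expR (- (t * l)).
  have e0 l : D l -> 0 <= e l by move=> _; exact: expR_ge0.
  have me : measurable_fun setT e.
    apply: measurableT_comp; first exact: measurable_expR.
    by apply: measurable_funN; apply: measurable_funM.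
  have ebb l : D l -> e l * b l <= b l.
    move=> Dl; rewrite ler_piMl ?b_ge0// expR_le1 oppr_le0.
    by rewrite mulr_ge0 ?(ltW t0)// D_ge0.
  have eby (m : {measure set (measurableTypeR R) -> \bar R}) :
      (\int[m]_(l in D) (b l)%:E < +oo)%E ->
      (\int[m]_(l in D) (e l * b l)%:E < +oo)%E.
    apply: le_lt_trans; apply: ge0_le_integral => //.
    + by move=> l Dl; rewrite lee_fin mulr_ge0 ?e0 ?b_ge0.
    + by apply/measurable_EFinP; apply: measurable_funTS; apply: measurable_funM.
    + by apply/measurable_EFinP; apply: measurable_funTS.
  (* P_t (-L)^s f is represented by the product e b: the vector (-L)^s f has spectral charge b
     dE_{f,g'}, and e <= 1 keeps e b integrable. *)
  suff re : spec_rep E (e \* b) f (heat E t (pow_op E s f)).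
    have eb0 l : D l -> 0 <= (e \* b) l by move=> Dl; rewrite mulr_ge0 ?e0 ?b_ge0.
    exact: (spec_rep_Rintegral eb0 re).
  move=> g'; have [py ny _] := rf g'.
  have [_ _ ->] := spec_heat_rep E (pow_op E s f) t0 g'.
  split; [exact: eby|exact: eby|].
  by have [_ _ ->] := spec_integral_comp mb b_ge0 me e0 rf (eby _ py) (eby _ ny)
    (fun A mA => erefl).
by split => // g; rewrite l2dotZl wE.
Qed.

(** Orthogonality to ker L removes the atom at 0 from both Jordan parts, so the boolean factor
    equals 1 almost everywhere. *)
Lemma spec_Rintegral_neq0 phi g : (forall h, op_ker L h -> l2dot f h = 0) ->
  measurable_fun setT phi ->
  spec_Rintegral E (fun l => (l != 0)%:R * phi l) f g = spec_Rintegral E phi f g.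
Proof.
move=> fker mphi; have [p0 n0] := orthogonal_kernel_spec0 hL fker g.
have m0 : measurable_fun setT (fun l : measurableTypeR R => (l != 0)%:R : R).
  rewrite (_ : (fun l => _) = \1_(~` [set 0])); last first.
    by apply/funext => l; rewrite indicE in_setC in_set1.
  by apply: measurable_indic; apply: measurableC; exact: measurable_set1.
have mset0 : measurable ([set 0] : set (measurableTypeR R)) by exact: measurable_set1.
have e (m : {measure set (measurableTypeR R) -> \bar R}) : m [set 0] = 0%E ->
    (\int[m]_(l in D) ((l != 0)%:R * phi l) = \int[m]_(l in D) phi l)%R.
  move=> mz; rewrite /Rintegral; congr fine; apply: ae_eq_integral => //.
  - by apply/measurable_EFinP; apply: measurable_funTS; apply: measurable_funM.
  - by apply/measurable_EFinP; apply: measurable_funTS.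
  - exists [set 0]; split; [exact: mset0|exact: mz|].
    move=> l /=; apply: contra_notP => /eqP l0 _.
    by rewrite l0 mul1r.
by rewrite /spec_Rintegral !e.
Qed.

End extension_formulas.

(** The two formulas are compared through their pairings: both give Gamma(s)^-1 times the integral
    of [gamma_avg s kernel0 y] against dE_{f,g}, and pairings determine a vector up to a null
    set. *)
Lemma extension_problem_solution d (T : measurableType d) (R : realType)
  (mu : {measure set T -> \bar R})
  (F : set (L2 mu)) (form : L2 mu -> L2 mu -> R)
  (E : spectralMeasure mu) (L : operator mu) (s a : R) (f : L2 mu) :
  generator F form E L -> 0 < s < 1 -> a = 1 - 2 * s ->
  op_dom (pow_op E s) f ->
  [/\ forall y, 0 < y -> weakly_integrable (extension_integrand E s f y),
      forall y, 0 < y -> weakly_integrable (poisson_integrand E s f y),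
      l2_weak_solution L a (poisson E s f) f &
      (forall h, op_ker L h -> l2dot f h = 0) ->
        l2_weak_solution L a (extension E s f) f /\
        forall y, 0 < y -> l2eq (extension E s f y) (poisson E s f y)].
Proof.
move=> hL hs ha hf.
have P y (y0 : 0 < y) := poisson_spec E f hs y0.
have X y (y0 : 0 < y) := extension_spec hs hf y0.
split=> [y /X[]//|y /P[]//||fker].
  by apply: l2_weak_solution_spec hL _ _ _ hs ha _ _ => y /P[].
have XP y : 0 < y -> forall g, l2dot (extension E s f y) g =
    (gammaR s)^-1 * spec_Rintegral E (gamma_avg s kernel0 y) f g.
  move=> y0 g; have [_ ->] := X y y0; congr (_ * _).
  apply: (spec_Rintegral_neq0 hL g fker).
  apply: (@measurable_gamma_avg _ _ hs kernel0 y 1 (measurable_kernel0 y)) => q.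
  by rewrite ger0_norm ?kernel0_le1// ltW// kernel0_gt0.
split; first exact: l2_weak_solution_spec hL _ _ _ hs ha _ XP.
move=> y y0; apply: l2eqP => g; have [_ PE] := P y y0.
exact: (etrans (XP y y0 g) (esym (PE g))).
Qed.

Theorem lemma3p1 (R : realType) (X : pmetricType R)
  (mu : {measure set (borelType X) -> \bar R})
  (F : set (L2 mu)) (form : L2 mu -> L2 mu -> R)
  (E : spectralMeasure mu) (L : operator mu) (s a : R) (f : L2 mu)
  (hX : locally_compact [set: X])
  (hmu : radon_measure mu) (hsupp : msupport mu = [set: X])
  (hform : dirichlet_form F form)
  (hL : generator F form E L)
  (hgap : no_spectral_gap (opN L))
  (hs : 0 < s < 1) (ha : a = 1 - 2 * s)
  (hf : op_dom (pow_op E s) f) :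
  [/\ forall y, 0 < y -> weakly_integrable (extension_integrand E s f y),
      forall y, 0 < y -> weakly_integrable (poisson_integrand E s f y),
      l2_weak_solution L a (poisson E s f) f &
      (forall h, op_ker L h -> l2dot f h = 0) ->
        l2_weak_solution L a (extension E s f) f /\
        forall y, 0 < y -> l2eq (extension E s f y) (poisson E s f y)].
Proof. exact: extension_problem_solution hL hs ha hf. Qed.
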